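(* Work in a monster model $\mathfrak{C}$ of a complete first-order theory in a language of arbitrary cardinality. Suppose that $H$ is a bounded index, invariant subgroup of a $\emptyset$-definable group $G$. Assume that $H$ is in $\mathcal{A}(\text{type-definable})$, while $K\geq H$ is a type-definable (with parameters) subgroup of $G$. Then either $H$ is relatively definable in $K$ (in which case $[K:H]$ is finite), or $[K:H]\geq 2^{\aleph_0}$.
   Context: A monster model is a model that is $\kappa$-saturated and strongly $\kappa$-homogeneous for a sufficiently large strong limit cardinal $\kappa$; ''small'' means of cardinality less than $\kappa$. Groups and subgroups are identified with their sets of points in $\mathfrak{C}$. ''Invariant'' means invariant under $\mathrm{Aut}(\mathfrak{C})$; ''type-definable'' means type-definable over a small set of parameters. Bounded index means index less than $\kappa$. $H$ is relatively definable in $K$ if it is the intersection of $K$ with a definable (with parameters) set. $\mathcal{A}(\text{type-definable})$ is the class of sets of the form $\bigcup_{\eta\in\omega^\omega}\bigcap_{n\in\omega}P_{\eta\restriction n}$ where $(P_s)_{s\in\omega^{<\omega}}$ is a family of type-definable sets (Souslin operation).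
   Formalization: ''Sufficiently large'' strong limit κ is taken to mean κ exceeds the size of the language and ℵ₀ and has uncountable cofinality; without the latter the claim can fail, since the countably many type-definable sets in the Souslin scheme need not share a small parameter set. *)

(* Defs.v *)
From mathcomp Require Import all_boot.
From mathcomp Require Import all_classical.

Set Implicit Arguments.
Unset Strict Implicit.
Unset Printing Implicit Defensive.

Local Open Scope classical_set_scope.
Local Open Scope card_scope.

(** * First-order logic *)

Record language := Language {
  func : Type;
  func_arity : func -> nat;
  rel_sym : Type;
  rel_arity : rel_sym -> nat }.

Record structure (L : language) := Structure {
  carrier :> Type;
  carrier_inhabited : inhabited carrier;
  func_interp : forall f : func L, (func_arity f).-tuple carrier -> carrier;
  rel_interp : forall r : rel_sym L, (rel_arity r).-tuple carrier -> Prop }.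

(* [formula L n]: formulas whose free variables are among x_0, ..., x_(n-1). *)
Inductive term (L : language) (n : nat) : Type :=
| Var of 'I_n
| App (f : func L) of ('I_(func_arity f) -> term L n).

Inductive formula (L : language) : nat -> Type :=
| Bot n : formula L n
| Eq n of term L n & term L n : formula L n
| Rel n (r : rel_sym L) of ('I_(rel_arity r) -> term L n) : formula L n
| Imp n of formula L n & formula L n : formula L n
(* the quantifier binds x_0; the free variable x_i becomes x_(i+1) *)
| All n of formula L n.+1 : formula L n.

Fixpoint term_eval (L : language) (M : structure L) n (v : n.-tuple M)
    (t : term L n) : M :=
  match t with
  | Var i => tnth v i
  | App f ts => func_interp [tuple term_eval v (ts i) | i < func_arity f]
  end.

Fixpoint sat (L : language) (M : structure L) n (phi : formula L n) :
    n.-tuple M -> Prop :=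
  match phi with
  | Bot _ => fun _ => False
  | Eq _ t u => fun v => term_eval v t = term_eval v u
  | Rel _ r ts => fun v => rel_interp [tuple term_eval v (ts i) | i < rel_arity r]
  | Imp _ phi1 phi2 => fun v => sat phi1 v -> sat phi2 v
  | All _ phi1 => fun v => forall x : M, sat phi1 [tuple of x :: v]
  end.

Definition sentence (L : language) := formula L 0.
Definition theory (L : language) := set (sentence L).

Definition models (L : language) (M : structure L) (T : theory L) : Prop :=
  forall phi, T phi -> sat (M := M) phi [tuple].

Definition entails (L : language) (T : theory L) (phi : sentence L) : Prop :=
  forall M : structure L, models M T -> sat (M := M) phi [tuple].

Definition complete_theory (L : language) (T : theory L) : Prop :=
  (exists M : structure L, models M T) /\
  forall phi : sentence L, entails T phi \/ entails T (Imp phi (Bot L 0)).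

Definition automorphism (L : language) (M : structure L) (s : M -> M) : Prop :=
  [/\ bijective s,
      forall f (a : (func_arity f).-tuple M),
        s (func_interp a) = func_interp (map_tuple s a)
    & forall r (a : (rel_arity r).-tuple M),
        rel_interp a <-> rel_interp (map_tuple s a)].

Definition aut_invariant (L : language) (M : structure L) n
    (X : set (n.-tuple M)) : Prop :=
  forall s : M -> M, automorphism s -> map_tuple s @` X = X.

(* [f] is only relevant on [A]. *)
Definition partial_elementary (L : language) (M : structure L) (A : set M)
    (f : M -> M) : Prop :=
  forall n (phi : formula L n) (a : n.-tuple M),
    (forall i, A (tnth a i)) -> sat phi a <-> sat phi (map_tuple f a).

(* A formula in the variables x_0, ..., x_(n-1) with parameters from [M]:
   the last [pf_len] free variables of [pf_body] stand for [pf_params]. *)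
Record pformula (L : language) (M : structure L) (n : nat) := PFormula {
  pf_len : nat;
  pf_body : formula L (n + pf_len);
  pf_params : pf_len.-tuple M }.

Section Definability.
Variables (L : language) (M : structure L) (n : nat).

Definition params_in (A : set M) (phi : pformula M n) : Prop :=
  forall i, A (tnth (pf_params phi) i).

Definition psat (phi : pformula M n) (a : n.-tuple M) : Prop :=
  sat (pf_body phi) [tuple of a ++ pf_params phi].

Definition definable_over (A : set M) (X : set (n.-tuple M)) : Prop :=
  exists phi : pformula M n, params_in A phi /\ X = psat phi.

Definition definable (X : set (n.-tuple M)) : Prop := definable_over setT X.

Definition realisations (p : set (pformula M n)) : set (n.-tuple M) :=
  [set a | forall phi, p phi -> psat phi a].

Definition type_definable_over (A : set M) (X : set (n.-tuple M)) : Prop :=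
  exists p : set (pformula M n), p `<=` params_in A /\ X = realisations p.

Definition finitely_satisfiable (p : set (pformula M n)) : Prop :=
  forall q : set (pformula M n), finite_set q -> q `<=` p ->
    realisations q !=set0.

End Definability.

(** * Cardinals and monster models *)

Definition card_lt T U (A : set T) (B : set U) : Prop := A #<= B /\ ~ (B #<= A).

(* The cardinal kappa is given as the cardinality of a type. *)
Definition small (kappa T : Type) (A : set T) : Prop := card_lt A [set: kappa].

Definition strong_limit (kappa : Type) : Prop :=
  forall A : set kappa, small kappa A ->
    small kappa [set B : set kappa | B `<=` A].

(* What "sufficiently large" amounts to: kappa exceeds |L| + aleph_0, and has
   uncountable cofinality, so that a countable family of type-definable sets is
   type-definable over a common small set. *)
Definition sufficiently_large (kappa : Type) (L : language) : Prop :=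
  [/\ small kappa [set: nat],
      small kappa [set: func L],
      small kappa [set: rel_sym L]
    & forall F : nat -> set kappa, (forall k, small kappa (F k)) ->
        small kappa (\bigcup_k F k)].

Definition saturated (kappa : Type) (L : language) (M : structure L) : Prop :=
  forall (A : set M) n (p : set (pformula M n)),
    small kappa A -> p `<=` params_in A -> finitely_satisfiable p ->
    realisations p !=set0.

Definition strongly_homogeneous (kappa : Type) (L : language)
    (M : structure L) : Prop :=
  forall (A : set M) (f : M -> M), small kappa A -> partial_elementary A f ->
    exists s : M -> M, automorphism s /\ forall x, A x -> s x = f x.

Definition monster (kappa : Type) (L : language) (M : structure L) : Prop :=
  [/\ strong_limit kappa, sufficiently_large kappa L,
      saturated kappa M & strongly_homogeneous kappa M].

Definition type_definable (kappa : Type) (L : language) (M : structure L) n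
    (X : set (n.-tuple M)) : Prop :=
  exists A : set M, small kappa A /\ type_definable_over A X.

(* [mkseq eta k] is the restriction of [eta] to k = {0, ..., k-1}. *)
Definition souslin (T : Type) (S : set (set T)) : set (set T) :=
  [set X | exists P : seq nat -> set T, (forall s, S (P s)) /\
     X = \bigcup_(eta in [set: nat -> nat]) \bigcap_k P (mkseq eta k)].

(** * Definable groups *)

(* A 0-definable group: [embed] identifies the group with a 0-definable subset
   of M^n on which the graph of the multiplication is 0-definable. *)
Record definable_group (L : language) (M : structure L) (n : nat) :=
  DefinableGroup {
    dg_sort :> groupType;
    embed : dg_sort -> n.-tuple M;
    embed_inj : injective embed;
    embed_definable : definable_over set0 (range embed);
    mul_definable : definable_over set0
      [set abc : (n + (n + n)).-tuple M | exists g h : dg_sort,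
         abc = [tuple of embed g ++ (embed h ++ embed (g * h)%g)]] }.

Definition points (L : language) (M : structure L) (n : nat)
    (G : definable_group M n) (X : set G) : set (n.-tuple M) :=
  @embed L M n G @` X.

Definition subgroup (G : groupType) (H : set G) : Prop :=
  group_closed [in H].

Definition left_cosets (G : groupType) (K H : set G) : set (set G) :=
  [set [set (x * h)%g | h in H] | x in K].

Definition relatively_definable (L : language) (M : structure L) n
    (X Y : set (n.-tuple M)) : Prop :=
  exists D : set (n.-tuple M), definable D /\ X = Y `&` D.

(* Main.v *)
(* Let A be a small set of parameters over which K and the sets of the Souslin
   scheme are type-definable and which contains representatives of the cosets of
   H. An automorphism over A fixes every coset of H, so the type of a point over
   A determines its coset modulo H, and even modulo the normal core of H. Hence
   an ultrafilter p on K has a value [real p] in K modulo this core, given by any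
   realization of its restriction to A, and [real] is multiplicative for the
   usual product p q of ultrafilters.

   Let X be a minimal closed set of ultrafilters on K invariant under left
   translation. Left translations and right products p |-> p q with q in X act
   on X so that preimages of meager sets are meager. The relation E on X x X
   saying that real p and real q lie in the same left coset of H is obtained by
   the Souslin operation from closed sets, so it is meager or comeager in some
   box (Nikodym). If E is meager, Mycielski's theorem gives a Cantor set of
   pairwise inequivalent points. If E is comeager in a box, finitely many
   translates of the box cover X x X by minimality; comparing with right
   products (p q, p'), for q ranging over countably many cosets, bounds the index
   [K : H].

   If the index is finite, H is comeager in an open subset of X, and so the coset
   of real p is generically the limit along p of the cosets of the elements of K.
   Right products extend this from generic points to X, and then to all
   ultrafilters on K, so no ultrafilter on H is realized outside H, and likewise
   for K \ H. By compactness H is relatively definable in K. *)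

Require Import Defs.
From mathcomp Require Import all_boot.
From mathcomp Require Import all_classical.

Set Implicit Arguments.
Unset Strict Implicit.
Unset Printing Implicit Defensive.

Local Open Scope classical_set_scope.
Local Open Scope card_scope.

(** * Baire category for a basis of sets *)

Section Category.
Variables (X : Type) (B : set (set X)).

(** Baire category is developed from a base alone: a common point for decreasing chains replaces
    compactness or completeness, and constant chains make basic sets nonempty. *)
Record category_basis : Prop := CategoryBasis {
  basis_meet : forall U V, B U -> B V -> U `&` V !=set0 ->
    exists2 W, B W & W `<=` U `&` V;
  basis_chain : forall U : nat -> set X, (forall n, B (U n)) ->
    (forall n, U n.+1 `<=` U n) -> exists x, forall n, U n x }.

Definition nowhere_dense (N : set X) :=
  forall U, B U -> exists V, [/\ B V, V `<=` U & V `&` N = set0].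

Definition meager (A : set X) :=
  exists N : nat -> set X,
    (forall k, nowhere_dense (N k)) /\ A `<=` \bigcup_k N k.

Lemma nowhere_dense_meager (N : set X) : nowhere_dense N -> meager N.
Proof. by move=> nN; exists (fun=> N); split=> // x Nx; exists 0. Qed.

Lemma sub_meager (A C : set X) : A `<=` C -> meager C -> meager A.
Proof. by move=> AC [N [nN CN]]; exists N; split=> //; apply: subset_trans CN. Qed.

Lemma meager0 : meager set0.
Proof.
apply: nowhere_dense_meager => U BU; exists U.
by split=> //; rewrite setI0.
Qed.

Lemma meager_bigcup (A : nat -> set X) :
  (forall n, meager (A n)) -> meager (\bigcup_n A n).
Proof.
move=> /choice[N nN].
pose N' k := if unpickle k is Some (n, j) then N n j else set0.
exists N'; split=> [k|x [n _ Anx]].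
  rewrite /N'; case: unpickle => [[n j]|]; first exact: (nN n).1.
  by move=> U BU; exists U; split=> //; rewrite setI0.
have [j _ Nx] := (nN n).2 _ Anx.
by exists (pickle (n, j)) => //; rewrite /N' pickleK.
Qed.

Lemma meager_bigcup_countable (I : countType) (A : I -> set X) :
  (forall i, meager (A i)) -> meager (\bigcup_i A i).
Proof.
move=> mA; apply: (@sub_meager _
  (\bigcup_n (if unpickle n is Some i then A i else set0))).
  by move=> x [i _ Ax]; exists (pickle i); rewrite ?pickleK.
by apply: meager_bigcup => n; case: unpickle => [i|]; [exact: mA|exact: meager0].
Qed.

Lemma meagerU (A C : set X) : meager A -> meager C -> meager (A `|` C).
Proof.
move=> mA mC; apply: (@sub_meager _ (\bigcup_(b in [set: bool]) if b then A else C)).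
  by move=> x [Ax|Cx]; [exists true|exists false].
by apply: meager_bigcup_countable => -[].
Qed.

Hypothesis B_basis : category_basis.

Lemma baire (A U : set X) : B U -> meager A -> exists2 x, U x & ~ A x.
Proof.
move=> BU [N [nN AN]].
have /choice[f fP] : forall p : nat * set X, exists V, B p.2 ->
    [/\ B V, V `<=` p.2 & V `&` N p.1 = set0].
  move=> [n V] /=; have [/(nN n)[W WP]|nB] := pselect (B V).
    by exists W.
  by exists V.
pose u := fix u n := if n is m.+1 then f (m, u m) else U.
have Bu n : B (u n) by elim: n => //= n IH; have [] := fP (n, u n) IH.
have uP n : [/\ B (u n.+1), u n.+1 `<=` u n & u n.+1 `&` N n = set0].
  exact: (fP (n, u n) (Bu n)).
have [n|x xu] := @basis_chain B_basis u Bu; first by have [] := uP n.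
exists x; first exact: (xu 0).
move=> /AN[n _ Nx]; have [_ _ uN] := uP n.
by rewrite -[False]/(set0 x) -uN; split.
Qed.

Lemma basis_nonempty (U : set X) : B U -> U !=set0.
Proof. by move=> BU; have [x] := baire BU meager0; exists x. Qed.

(* A maximal disjoint family of basic sets in which [A] is meager is dense, so
   the pieces of the meager covers inside its members glue together. *)
Lemma banach_category (A : set X) :
  (forall U, B U -> exists V, [/\ B V, V `<=` U & meager (A `&` V)]) ->
  meager A.
Proof.
move=> locA.
pose D := [set V : set X | B V /\ meager (A `&` V)].
have [E [ED tE maxE]] := ex_maximal_disjoint_subcollection (@id (set X)) D.
have /choice[N NP] : forall V, exists N : nat -> set X, E V ->
    (forall k, nowhere_dense (N k)) /\ A `&` V `<=` \bigcup_k N k.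
  move=> V; have [/ED[_ [N NP]]|nE] := pselect (E V); first by exists N.
  by exists (fun=> set0).
have Emeet U : B U -> exists V, E V /\ U `&` V !=set0.
  move=> /locA[V [BV VU mV]]; apply: contrapT => noE.
  have disj W : E W -> V `&` W = set0.
    move=> EW; apply/eqP; apply: contrapT => /negP/set0P[x [Vx Wx]].
    by apply: noE; exists W; split=> //; exists x; split=> //; exact: VU.
  have nEV : ~ E V.
    move=> /disj; rewrite setIid => V0.
    by have := basis_nonempty BV; rewrite V0 => -[].
  apply: (maxE (E `|` [set V])).
  - split; first by move=> W; left.
    by move=> /(_ V) EV; apply/nEV/EV; right.
  - by move=> W [/ED//|->].
  - move=> W1 W2 [E1|->] [E2|->] //.
    + exact: tE.
    + by move=> [x [W1x Vx]]; suff: set0 x by []; rewrite -(disj _ E1); split.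
    + by move=> [x [Vx W2x]]; suff: set0 x by []; rewrite -(disj _ E2); split.
pose M k := \bigcup_(V in E) (V `&` N V k).
have nM k : nowhere_dense (M k).
  move=> U BU; have [V [EV UV]] := Emeet U BU.
  have [BV _] := ED _ EV.
  have [W BW WUV] := basis_meet B_basis BU BV UV.
  have [W' [BW' W'W W'N]] := (NP V EV).1 k W BW.
  exists W'; split=> //; first by move=> x /W'W/WUV[].
  rewrite -subset0 => x [W'x [V' EV' [V'x Nx]]]; rewrite -W'N; split=> //.
  suff -> : V = V' by [].
  by apply: tE => //; exists x; split=> //; have [] := WUV x (W'W x W'x).
have nR : nowhere_dense (~` (\bigcup_(V in E) V)).
  move=> U BU; have [V [EV UV]] := Emeet U BU.
  have [BV _] := ED _ EV.
  have [W BW WUV] := basis_meet B_basis BU BV UV.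
  exists W; split=> //; first by move=> x /WUV[].
  by rewrite -subset0 => x [Wx]; apply; exists V => //; have [] := WUV x Wx.
apply: (@sub_meager _ ((~` (\bigcup_(V in E) V)) `|` \bigcup_k M k)).
  move=> x Ax; have [[V EV Vx]|nx] := pselect ((\bigcup_(V in E) V) x); last by left.
  right; have [k _ Nx] := (NP V EV).2 x (conj Ax Vx).
  by exists k => //; exists V.
apply: meagerU; first exact: nowhere_dense_meager.
by apply: meager_bigcup => k; exact: nowhere_dense_meager.
Qed.

Definition everywhere_nonmeager (A U : set X) :=
  forall V, B V -> V `<=` U -> ~ meager (A `&` V).

(** Otherwise the part of [A] in [U] would be locally meager, hence meager by [banach_category]. *)
Lemma nonmeager_somewhere (A U : set X) : B U -> ~ meager (A `&` U) ->
  exists V, [/\ B V, V `<=` U & everywhere_nonmeager A V].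
Proof.
move=> BU nmA; apply: contrapT => noV; apply/nmA/banach_category => V BV.
have [VU|VU] := pselect (V `&` U !=set0); last first.
  exists V; split=> //; apply: sub_meager meager0 => x [[_ Ux] Vx].
  by apply: VU; exists x.
have [W BW WVU] := basis_meet B_basis BV BU VU.
apply: contrapT => noW; apply: noV; exists W.
split=> // [x /WVU[]//|W' BW' W'W mW']; apply: noW; exists W'.
split=> //; first by move=> x /W'W/WVU[].
by apply: sub_meager mW' => x [[]].
Qed.

Definition basis_closed (C : set X) :=
  forall x, ~ C x -> exists U, [/\ B U, U x & U `&` C = set0].

(* With [V s] the open set where [A s] is everywhere nonmeager, each
   [V s `\` \bigcup_n V (rcons s n)] is nowhere dense, and a point of [V [::]]
   avoiding all of these lies on a branch of the scheme. *)
Lemma nikodym (A C : seq nat -> set X) :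
  (forall s, basis_closed (C s)) -> (forall s, A s `<=` C s) ->
  (forall s, A s `<=` \bigcup_n A (rcons s n)) ->
  (forall x (eta : nat -> nat), (forall n, C (mkseq eta n) x) -> A [::] x) ->
  ~ meager (A [::]) -> exists2 U, B U & meager (U `\` A [::]).
Proof.
move=> clC AC AU branch nmA.
pose V s := \bigcup_(U in [set U | B U /\ everywhere_nonmeager (A s) U]) U.
pose M s := V s `\` \bigcup_n V (rcons s n).
have nM s : nowhere_dense (M s).
  move=> U BU; have [UV|UV] := pselect (U `&` V s !=set0); last first.
    by exists U; split=> //; rewrite -subset0 => x [Ux [Vx _]]; apply: UV; exists x.
  have [x [Ux [V' [BV' eV'] V'x]]] := UV.
  have [W BW WUV] : exists2 W, B W & W `<=` U `&` V'.
    by apply: (basis_meet B_basis) => //; exists x.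
  have nmW : ~ meager (A s `&` W) by apply: eV' => // y /WUV[].
  (* Meager sets form a sigma-ideal, so one of the countably many successors stays nonmeager in
     [W]. *)
  have [n nmn] : exists n, ~ meager (A (rcons s n) `&` W).
    apply: contrapT => /forallNP mn; apply: nmW.
    apply: (@sub_meager _ (\bigcup_n (A (rcons s n) `&` W))).
      by move=> y [/AU[n _ Any] Wy]; exists n.
    by apply: meager_bigcup => n; exact: contrapT (mn n).
  have [V2 [BV2 V2W eV2]] := nonmeager_somewhere BW nmn.
  exists V2; split=> //; first by move=> y /V2W/WUV[].
  by rewrite -subset0 => y [V2y [_]]; apply; exists n => //; exists V2.
have VC s : V s `<=` C s.
  move=> x [U [BU eU] Ux]; apply: contrapT => /clC[W [BW Wx WC]].
  have [W' BW' W'UW] : exists2 W', B W' & W' `<=` U `&` W.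
    by apply: (basis_meet B_basis) => //; exists x.
  apply: (eU W') => //; first by move=> y /W'UW[].
  apply: sub_meager meager0 => y [/AC Cy /W'UW[_ Wy]].
  by rewrite -WC.
have [U1 [BU1 _ eU1]] : exists U,
    [/\ B U, True & everywhere_nonmeager (A [::]) U].
  apply: contrapT => noU; apply: nmA; apply: banach_category => W BW.
  apply: contrapT => noW; apply: noU; exists W; split=> // W' BW' W'W mW'.
  by apply: noW; exists W'.
exists U1 => //; apply: (@sub_meager _ (\bigcup_s M s)); last first.
  by apply: meager_bigcup_countable => s; exact: nowhere_dense_meager.
move=> x [U1x nAx]; apply: contrapT => nMx; apply: nAx.
(* Off [V s] the value 0 is a dummy that makes the choice of successors total. *)
have Vnext s : exists n, V s x -> V (rcons s n) x.
  have [Vx|nVx] := pselect (V s x); last by exists 0.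
  apply: contrapT => noV; apply: nMx; exists s => //; split=> // -[n _ Vn].
  by apply: noV; exists n.
have [f fP] := choice Vnext.
pose t := fix t n := if n is m.+1 then rcons (t m) (f (t m)) else [::].
have Vt n : V (t n) x.
  by elim: n => [|n IH]; [exists U1|exact: fP].
apply: (branch x (fun n => f (t n))) => n; apply: VC.
suff -> : mkseq (fun n => f (t n)) n = t n by exact: Vt.
by elim: n => // n IH; rewrite mkseqS IH.
Qed.

End Category.

Section Products.
Variables (X Y : Type) (B : set (set X)) (B' : set (set Y)).

Definition boxes : set (set (X * Y)) :=
  [set W | exists U V, [/\ B U, B' V & W = U `*` V]].

Lemma boxes_basis :
  category_basis B -> category_basis B' -> category_basis boxes.
Proof.
move=> bB bB'; split.
  move=> _ _ [U1 [V1 [BU1 BV1 ->]]] [U2 [V2 [BU2 BV2 ->]]].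
  move=> [[x y] [[/= U1x V1y] [/= U2x V2y]]].
  have [U BU UU] : exists2 U, B U & U `<=` U1 `&` U2.
    by apply: (basis_meet bB) => //; exists x.
  have [V BV VV] : exists2 V, B' V & V `<=` V1 `&` V2.
    by apply: (basis_meet bB') => //; exists y.
  exists (U `*` V); first by exists U, V.
  by move=> [a b] [/= /UU[? ?] /VV[? ?]].
move=> W BW decW.
have /choice[u uP] : forall n, exists U, exists V, [/\ B U, B' V & W n = U `*` V].
  by move=> n; exact: BW.
have /choice[v vP] := uP.
(* A box determines its sides only when it is nonempty, so points [a] and [b] of the sides serve to
   project the inclusion. *)
have sub n : u n.+1 `<=` u n /\ v n.+1 `<=` v n.
  have [B1 B1' E1] := vP n.+1; have [B0 B0' E0] := vP n.
  have [a ua] := basis_nonempty bB B1; have [b vb] := basis_nonempty bB' B1'.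
  split=> [x ux|y vy].
    have := @decW n (x, b); rewrite E1 E0 => /(_ (conj ux vb))[].
    by [].
  have := @decW n (a, y); rewrite E1 E0 => /(_ (conj ua vy))[].
  by [].
have [n|n|x xu] := basis_chain bB (U := u); first by have [] := vP n.
  by have [] := sub n.
have [n|n|y yv] := basis_chain bB' (U := v); first by have [] := vP n.
  by have [] := sub n.
by exists (x, y) => n; have [_ _ ->] := vP n; split=> /=; [exact: xu|exact: yv].
Qed.

End Products.

(** * Maps along which meager sets pull back *)

Section SemiOpen.

(** For a continuous map this says that the image of a basic set is dense in some basic set. This is
    weaker than openness and suffices to pull back meager sets. *)
Definition semiopen (X Y : Type) (B : set (set X)) (B' : set (set Y))
    (phi : X -> Y) :=
  forall U, B U -> exists V, B' V /\ forall V', B' V' -> V' `<=` V ->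
    exists U', [/\ B U', U' `<=` U & phi @` U' `<=` V'].

Lemma semiopen_comp (X Y Z : Type) (B : set (set X)) (B' : set (set Y))
    (B'' : set (set Z)) (phi : X -> Y) (psi : Y -> Z) :
  semiopen B B' phi -> semiopen B' B'' psi -> semiopen B B'' (psi \o phi).
Proof.
move=> ophi opsi U /ophi[V [/opsi[W [BW VW]] UV]]; exists W.
split=> // W' BW' /(VW _ BW')[V' [BV' V'V V'W']].
have [U' [BU' U'U U'V']] := UV V' BV' V'V.
exists U'; split=> // _ [x U'x <-]; apply: V'W'; exists (phi x) => //.
by apply: U'V'; exists x.
Qed.

Lemma semiopen_prod (X X' Y Y' : Type) (B1 : set (set X)) (B2 : set (set X'))
    (B1' : set (set Y)) (B2' : set (set Y')) (phi : X -> Y) (psi : X' -> Y') :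
  category_basis B1' -> category_basis B2' ->
  semiopen B1 B1' phi -> semiopen B2 B2' psi ->
  semiopen (boxes B1 B2) (boxes B1' B2') (fun x => (phi x.1, psi x.2)).
Proof.
move=> b1 b2 ophi opsi _ [U1 [U2 [BU1 BU2 ->]]].
have [V1 [BV1 UV1]] := ophi _ BU1; have [V2 [BV2 UV2]] := opsi _ BU2.
exists (V1 `*` V2); split; first by exists V1, V2.
move=> _ [W1 [W2 [BW1 BW2 ->]]] WV.
have [y1 W1y] := basis_nonempty b1 BW1; have [y2 W2y] := basis_nonempty b2 BW2.
have [|U1' [BU1' U1'U U1'W]] := UV1 _ BW1.
  by move=> y W1y'; have [] := WV (y, y2) (conj W1y' W2y).
have [|U2' [BU2' U2'U U2'W]] := UV2 _ BW2.
  by move=> y W2y'; have [] := WV (y1, y) (conj W1y W2y').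
exists (U1' `*` U2'); split; first by exists U1', U2'.
  by move=> [x y] [/= /U1'U ? /U2'U ?].
move=> _ [[x y] [/= U1x U2y] <-]; split=> /=.
  by apply: U1'W; exists x.
by apply: U2'W; exists y.
Qed.

Lemma meager_preimage (X Y : Type) (B : set (set X)) (B' : set (set Y))
    (phi : X -> Y) (A : set Y) :
  semiopen B B' phi -> meager B' A -> meager B (phi @^-1` A).
Proof.
move=> ophi [N [nN AN]]; exists (fun k => phi @^-1` N k); split=> [k U BU|x].
  have [V [BV UV]] := ophi U BU.
  have [V' [BV' V'V V'N]] := nN k V BV.
  have [U' [BU' U'U U'V']] := UV V' BV' V'V.
  exists U'; split=> //; rewrite -subset0 => x [U'x Nx].
  suff: (set0 : set Y) (phi x) by [].
  by rewrite -V'N; split=> //; apply: U'V'; exists x.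
by move=> /AN[k _ Nk]; exists k.
Qed.

End SemiOpen.

(** * Mycielski's theorem *)

Section Mycielski.
Variables (X : Type) (B : set (set X)).
Hypothesis B_basis : category_basis B.

(** One stage of a fusion: finitely many requirements, each on a pair of distinct words, are met one
    after another. Shrinking the sets never spoils a requirement already met. *)
Lemma shrink_family (N : nat -> set (X * X))
    (l : seq ((seq bool * seq bool) * nat)) (f : seq bool -> set X) :
  (forall k, nowhere_dense (boxes B B) (N k)) ->
  (forall x, x \in l -> x.1.1 != x.1.2) -> (forall s, B (f s)) ->
  exists f' : seq bool -> set X, [/\ forall s, B (f' s), forall s, f' s `<=` f s
    & forall x, x \in l -> (f' x.1.1 `*` f' x.1.2) `&` N x.2 = set0].
Proof.
move=> nN; elim: l => [|[[s t] k] l IH] neq Bf.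
  by exists f; split=> // s x.
have [f1 [Bf1 f1f f1N]] : exists f' : seq bool -> set X,
    [/\ forall s, B (f' s), forall s, f' s `<=` f s
    & forall x, x \in l -> (f' x.1.1 `*` f' x.1.2) `&` N x.2 = set0].
  by apply: IH => // x xl; apply: neq; rewrite inE xl orbT.
have st : s != t by apply: (neq (s, t, k)); rewrite mem_head.
have [_ [[V1 [V2 [BV1 BV2 ->]]] V12 VN]] : exists V,
    [/\ boxes B B V, V `<=` f1 s `*` f1 t & V `&` N k = set0].
  by apply: nN; exists (f1 s), (f1 t).
have [x1 Vx1] := basis_nonempty B_basis BV1.
have [x2 Vx2] := basis_nonempty B_basis BV2.
pose f' r := if r == s then V1 else if r == t then V2 else f1 r.
have f'f1 r : f' r `<=` f1 r.
  rewrite /f'; case: eqP => [->|_] x Vx.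
    by have [] := V12 (x, x2) (conj Vx Vx2).
  case: eqP Vx => [->|_] // Vx.
  by have [] := V12 (x1, x) (conj Vx1 Vx).
exists f'; split=> [r|r|x].
- by rewrite /f'; case: eqP => // _; case: eqP.
- exact: subset_trans (f1f r).
- rewrite inE => /predU1P[->/=|/f1N xN].
    by rewrite /f' eqxx eq_sym (negbTE st) eqxx.
  rewrite -subset0 -xN => -[y z] [[/= fy fz] Nyz].
  by split=> //; split=> /=; exact: f'f1.
Qed.

Lemma mycielski (E : set (X * X)) (U : set X) :
  B U -> meager (boxes B B) E ->
  exists2 p : (nat -> bool) -> X, forall eta, U (p eta) &
    forall eta zeta, eta <> zeta -> ~ E (p eta, p zeta).
Proof.
move=> BU [N [nN EN]].
have step : forall nf : nat * (seq bool -> set X), exists f',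
    (forall s, B (nf.2 s)) -> [/\ forall s, B (f' s),
      forall s, f' s `<=` nf.2 (take nf.1 s)
    & forall s t k, size s = nf.1.+1 -> size t = nf.1.+1 -> s != t ->
        k <= nf.1 -> (f' s `*` f' t) `&` N k = set0].
  move=> [n f] /=; have [Bf|nBf] := pselect (forall s, B (f s)); last first.
    by exists f.
  pose T := n.+1.-tuple bool.
  pose l := [seq x <- [seq ((val st.1, val st.2), k) |
    st <- enum {: T * T}, k <- iota 0 n.+1] | x.1.1 != x.1.2].
  have [|s|f' [Bf' f'f f'N]] := @shrink_family N l (fun s => f (take n s)) nN.
  - by move=> x; rewrite mem_filter => /andP[].
  - exact: Bf.
  exists f' => _; split=> // s t k /eqP ss /eqP st neq kn.
  apply: (f'N ((s, t), k)); rewrite mem_filter; apply/andP; split=> //.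
  apply/allpairsPdep; exists (Tuple ss : T, Tuple st : T), k.
  by rewrite mem_enum mem_iota.
have {step}[g gP] := choice step.
pose F := fix F n := if n is m.+1 then g (m, F m) else fun=> U.
have BF n : forall s, B (F n s).
  by elim: n => [|n IH] //; have [] := gP (n, F n) IH.
have FP n := gP (n, F n) (BF n).
have /choice[p pP] : forall eta : nat -> bool,
    exists x, forall n, F n (mkseq eta n) x.
  move=> eta; apply: (basis_chain B_basis (U := fun n => F n (mkseq eta n))) => n.
    exact: BF.
  have [_ /(_ (mkseq eta n.+1)) + _] := FP n.
  by rewrite mkseqS -cats1 take_size_cat ?size_mkseq.
exists p => [eta|eta zeta neq /EN[k _ Nk]]; first exact: (pP eta 0).
have [m neqm] : exists m, eta m <> zeta m.
  by apply: contrapT => /forallNP eqm; apply/neq/funext => m; exact: contrapT.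
(* Since [n >= m], the two branches pass through distinct words at stage [n]; since [n >= k], this
   stage avoids [N k]. *)
pose n := maxn m k.
have [_ _ /(_ (mkseq eta n.+1) (mkseq zeta n.+1) k)] := FP n.
rewrite !size_mkseq => /(_ erefl erefl); case: eqP => [eqs|_ /(_ isT)].
  have := congr1 (nth false ^~ m) eqs.
  by rewrite !nth_mkseq ?ltnS ?leq_maxl.
move=> /(_ (leq_maxr _ _)) FN.
suff: (set0 : set (X * X)) (p eta, p zeta) by [].
by rewrite -FN; split=> //; split; exact: (pP _ n.+1).
Qed.

End Mycielski.

(** * Products of ultrafilters and minimal flows *)

Section Ultrafilters.

Lemma ultra_criterion (T : Type) (p : set_system T) :
  ProperFilter p -> (forall A, p A \/ p (~` A)) -> UltraFilter p.
Proof.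
move=> pP dec; split=> // q qP pq; apply/seteqP; split=> // A qA.
have [//|/pq qnA] := dec A.
by case: (filter_not_empty q); rewrite -(setICr A); exact: filterI.
Qed.

Lemma ultra_bigcup_seq (T : Type) (I : eqType) (p : set_system T) (s : seq I)
    (A : I -> set T) :
  UltraFilter p -> p [set x | exists2 i, i \in s & A i x] ->
  exists2 i, i \in s & p (A i).
Proof.
move=> pU; elim: s => [|i s IH] ps.
  by case: (filter_not_empty p); apply: filterS ps => x [].
have [pA|pnA] := in_ultra_setVsetC (A i) pU.
  by exists i => //; rewrite mem_head.
have [|j js pj] := IH; last by exists j => //; rewrite inE js orbT.
apply: filterS (filterI ps pnA) => x [[j]].
by rewrite inE => /predU1P[->//|js Aj _]; exists j.
Qed.

(** The Fubini product: a limit along [p] of limits along [q]. *)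
Definition lim2 (T U : Type) (p : set_system T) (q : set_system U) :
    set_system (T * U) :=
  [set Z | p [set a | q [set b | Z (a, b)]]].

Lemma lim2_proper (T U : Type) (p : set_system T) (q : set_system U) :
  ProperFilter p -> ProperFilter q -> ProperFilter (lim2 p q).
Proof.
move=> pP qP; split=> [/=|].
  by move=> /(@filter_ex _ p)[a]; apply: (filter_not_empty q).
split=> [|Y Z pY pZ|Y Z YZ]; rewrite /lim2 /=.
- by apply: filterE => a; apply: filterE.
- by apply: (@filterS _ p _ _ _ _ (@filterI _ p _ _ _ pY pZ)) => a [];
    exact: filterI.
- by apply: filterS => a; apply: filterS => b; exact: YZ.
Qed.

(* With this order of the two limits, the product is continuous in [p]. *)
Definition mulu (G : groupType) (p q : set_system G) : set_system G :=
  [set X | lim2 p q [set z | X (z.1 * z.2)%g]].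

Lemma mulu_ultra (G : groupType) (p q : set_system G) :
  UltraFilter p -> UltraFilter q -> UltraFilter (mulu p q).
Proof.
move=> pU qU; have lP := lim2_proper (@ultra_proper _ p _) (@ultra_proper _ q _).
apply: ultra_criterion => [|A].
  split; first exact: (filter_not_empty (lim2 p q)).
  split=> [|Y Z pY pZ|Y Z YZ]; rewrite /mulu /=.
  - exact: (@filterT _ (lim2 p q)).
  - exact: (@filterI _ (lim2 p q)) pY pZ.
  - by apply: (@filterS _ (lim2 p q)) => z; exact: YZ.
have [|pA] := in_ultra_setVsetC [set a | q [set b | A (a * b)%g]] pU.
  by left.
right; apply: filterS pA => a /= nqA.
by have [//|] := in_ultra_setVsetC [set b | A (a * b)%g] qU.
Qed.

(** The left translate [gD], as a preimage. *)
Definition translate (G : groupType) (g : G) (D : set G) : set G :=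
  [set x | D (g^-1 * x)%g].

Lemma translateM (G : groupType) (g h : G) (D : set G) :
  translate (g * h)%g D = translate g (translate h D).
Proof. by apply/funext => x; rewrite /translate /= invgM mulgA. Qed.

Lemma translateK (G : groupType) (g : G) (D : set G) :
  translate g^-1%g (translate g D) = D.
Proof.
by rewrite -translateM mulVg; apply/funext => x; rewrite /translate /= invg1 mul1g.
Qed.

Lemma mulu_principal (G : groupType) (g : G) (q : set_system G) (X : set G) :
  mulu (principal_filter g) q X = q (translate g^-1%g X).
Proof.
rewrite /mulu /lim2 /translate /= invgK.
by apply/propext; split=> [/principal_filterP//|?]; apply/principal_filterP.
Qed.

End Ultrafilters.

(** * Minimal flows of ultrafilters *)

Section Flow.
Variables (G : groupType) (K : set G).
Hypotheses (K1 : K 1%g) (KM : forall x y, K x -> K y -> K (x * y)%g)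
  (KV : forall x, K x -> K x^-1%g).

Record invariant_filter (F : set_system G) : Prop := InvariantFilter {
  invf_proper : ProperFilter F;
  invf_K : F K;
  invf_translate : forall g X, K g -> F X -> F (translate g X) }.

(* The closed set of ultrafilters finer than a maximal invariant filter is a
   minimal closed set invariant under left translations. *)
Lemma maximal_invariant_filter : exists2 F, invariant_filter F &
  forall F', invariant_filter F' -> F `<=` F' -> F' `<=` F.
Proof.
pose P (F : set_system G) := F = set0 \/ invariant_filter F.
have [C CP totC|F [PF maxF]] := @Zorn_bigcup _ P.
  have [[F0 [CF0 invF0]]|noF] := pselect (exists F, C F /\ invariant_filter F);
    last first.
    left; rewrite -subset0 => X [F CF FX]; have [F0|] := CP F CF.
      by rewrite -F0.
    by move=> iF; apply: noF; exists F.
  have Cinv F X : C F -> F X -> invariant_filter F.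
    by move=> CF FX; have [F0'|//] := CP F CF; rewrite F0' in FX.
  right; split.
  - split=> [[F CF F0']|].
      by have FP := invf_proper (Cinv F _ CF F0'); exact: (filter_not_empty F).
    split=> [|X Y [F CF FX] [F' CF' FY]|X Y XY [F CF FX]].
    + by exists F0 => //; have F0P := invf_proper invF0; exact: filterT.
    + have [FF'|F'F] := totC _ _ CF CF'.
        exists F' => //; have F'P := invf_proper (Cinv _ _ CF' FY).
        by apply: filterI => //; exact: FF'.
      exists F => //; have FP := invf_proper (Cinv _ _ CF FX).
      by apply: filterI => //; exact: F'F.
    + exists F => //; have FP := invf_proper (Cinv _ _ CF FX).
      exact: filterS FX.
  - by exists F0 => //; exact: invf_K.
  - move=> g X Kg [F CF FX]; exists F => //.
    exact: invf_translate (Cinv _ _ CF FX) _ _ Kg FX.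
(* The supersets of [K] form an invariant filter, so the maximal element is not empty. *)
have inv0 : invariant_filter [set X | K `<=` X].
  split=> //=.
    split=> /= [/(_ _ K1)//|]; split=> //= [X Y KX KY x Kx|X Y XY KX x /KX/XY//].
    by split; [exact: KX|exact: KY].
  by move=> g X Kg KX x Kx; apply: KX; apply: KM => //; exact: KV.
have invF : invariant_filter F.
  have [F0|//] := PF; exfalso; apply: (maxF [set X | K `<=` X]); last by right.
  by rewrite F0; split=> // /(_ K); apply.
exists F => // F' invF' FF'; apply: contrapT => nF'F.
by apply: (maxF F'); [split|right].
Qed.

Variable F : set_system G.
Hypotheses (F_inv : invariant_filter F)
  (F_max : forall F', invariant_filter F' -> F `<=` F' -> F' `<=` F).

Let F_proper : ProperFilter F := invf_proper F_inv.
Local Existing Instance F_proper.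

(** Positive sets are those belonging to some ultrafilter finer than [F], so that their clopen sets
    meet the flow. *)
Definition positive (D : set G) := ~ F (~` D).

Lemma positive_translate (g : G) (D : set G) :
  K g -> positive D -> positive (translate g D).
Proof.
move=> Kg pD FgD; apply: pD.
by have := invf_translate F_inv (KV Kg) FgD; rewrite -[~` D](translateK g).
Qed.

(** Minimality of the flow. If no finite union of translates of [D] were in [F], adjoining the
    complements of all these translates to [F] would give a proper invariant filter; by maximality
    the complement of [D] would be in [F]. *)
Lemma syndetic (D : set G) : positive D -> exists2 gs : seq G,
  (forall g, g \in gs -> K g) &
  F [set x | exists2 g, g \in gs & translate g D x].
Proof.
move=> pD; apply: contrapT => nsyn; apply: pD.
pose F' : set_system G := [set Z | exists gs : seq G, exists S : set G,
  [/\ forall g, g \in gs -> K g, F S &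
    forall x, S x -> (forall g, g \in gs -> ~ translate g D x) -> Z x]].
apply: (F_max (F' := F')).
- split.
  + split=> [[gs [S [Kgs FS SD]]]|].
      apply: nsyn; exists gs => //; apply: filterS FS => x Sx.
      apply: contrapT => nD; apply: (SD x Sx) => g gsg gD.
      by apply: nD; exists g.
    split=> [|X Y [gs [S [Kgs FS SX]]] [gs' [S' [Kgs' FS' SY]]]|X Y XY].
    * by exists [::], setT; split=> //; exact: filterT.
    * exists (gs ++ gs'), (S `&` S'); split; last 2 first.
      - exact: filterI.
      - move=> x [Sx S'x] nD; split.
          by apply: SX => // g gsg; apply: nD; rewrite mem_cat gsg.
        by apply: SY => // g gsg; apply: nD; rewrite mem_cat gsg orbT.
      by move=> g; rewrite mem_cat => /orP[/Kgs|/Kgs'].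
    * move=> [gs [S [Kgs FS SX]]]; exists gs, S; split=> // x Sx nD.
      exact/XY/SX.
  + by exists [::], K; split=> //; exact: invf_K.
  + move=> g Z Kg [gs [S [Kgs FS SZ]]].
    exists [seq (g * h)%g | h <- gs], (translate g S); split.
    * by move=> _ /mapP[h /Kgs Kh ->]; exact: KM.
    * exact: invf_translate.
    * move=> x Sx nD; apply: SZ => // h hgs.
      have := nD (g * h)%g (map_f _ hgs); rewrite translateM; exact.
- by move=> Z FZ; exists [::], Z.
- exists [:: 1%g], setT; split=> //; first by move=> g; rewrite inE => /eqP ->.
    exact: filterT.
  move=> x _ /(_ 1%g); rewrite mem_head => /(_ isT).
  by rewrite /translate /= invg1 mul1g.
Qed.

Definition flow : set (set_system G) := [set p | UltraFilter p /\ F `<=` p].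

Lemma flow_K (p : set_system G) : flow p -> UltraFilter p /\ p K.
Proof. by move=> [pU Fp]; split=> //; exact: Fp _ (invf_K F_inv). Qed.

Lemma flow_positive (p : set_system G) (D : set G) : flow p -> p D -> positive D.
Proof.
move=> [pU Fp] pD /Fp pnD.
by apply: (filter_not_empty p); rewrite -(setICr D); exact: filterI.
Qed.

(** Compactness of the flow: any ultrafilter finer than the filter generated by [F] and the sets
    [D n] will do. *)
Lemma positive_chain (D : nat -> set G) : (forall n, positive (D n)) ->
  (forall n m, n <= m -> D m `<=` D n) -> exists2 p, flow p & forall n, p (D n).
Proof.
move=> pD decD.
pose F' : set_system G := [set Z | exists n, F (~` D n `|` Z)].
have F'P : ProperFilter F'.
  split=> [[n]|]; first by rewrite setU0; exact: pD.
  split=> [|X Y [n FX] [m FY]|X Y XY [n FX]].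
  - by exists 0; rewrite setUT; exact: filterT.
  - exists (maxn n m); apply: filterS (filterI FX FY) => x [[nD|Xx] [nD'|Yx]].
    + by left => /(decD _ _ (leq_maxl n m)).
    + by left => /(decD _ _ (leq_maxl n m)).
    + by left => /(decD _ _ (leq_maxr n m)).
    + by right.
  - by exists n; apply: filterS FX => x [|/XY]; [left|right].
have [p [pU F'p]] := ultraFilterLemma F'P.
exists p => [|n]; last first.
  by apply: F'p; exists n; apply: filterE => x; case: (pselect (D n x)); [right|left].
split=> // X FX; apply: F'p; exists 0; apply: filterS FX; exact: subsetUr.
Qed.

Definition flow_basis : set (set (set_system G)) :=
  [set U | exists2 D, positive D & U = [set p | flow p /\ p D]].

Lemma flow_basisP (D : set G) : positive D ->
  flow_basis [set p | flow p /\ p D].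
Proof. by move=> pD; exists D. Qed.

Lemma flow_category : category_basis flow_basis.
Proof.
split=> [_ _ [D1 pD1 ->] [D2 pD2 ->] [p [[fp pD1p] [_ pD2p]]]|U BU decU].
  have pU := fp.1; exists [set q | flow q /\ q (D1 `&` D2)].
    by exists (D1 `&` D2) => //; apply: flow_positive fp _; exact: filterI.
  move=> q [fq qD]; have qU := fq.1.
  by split; split=> //; apply: filterS qD => x [].
have /choice[D DP] : forall n, exists D, positive D /\ U n = [set p | flow p /\ p D].
  by move=> n; have [D pD ->] := BU n; exists D.
(* The clopen sets [U n] decrease only as seen by the flow; the finite intersections [D' n] decrease
   as sets. *)
pose D' n := [set x | forall i, i <= n -> D i x].
have pDD' n q : flow q -> U n q -> q (D' n).
  move=> fq; have qU := fq.1; elim: n => [|n IH] Uq.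
    have := Uq; rewrite (DP 0).2 => -[_]; apply: filterS => x Dx i.
    by rewrite leqn0 => /eqP ->.
  have := Uq; rewrite (DP n.+1).2 => -[_ qD].
  apply: filterS (filterI (IH (decU _ _ Uq)) qD) => x [D'x Dx] i.
  by rewrite leq_eqVlt => /predU1P[->//|]; rewrite ltnS; exact: D'x.
have posD' n : positive (D' n).
  have [q fq qDn] := positive_chain (fun=> (DP n).1) (fun _ _ _ => @subset_refl _ _).
  apply: (flow_positive fq); apply: pDD' => //.
  by rewrite (DP n).2; split=> //; exact: (qDn 0).
have [|p fp pD'] := positive_chain posD'.
  by move=> n m nm x D'x i ni; apply: D'x; exact: leq_trans nm.
have pU := fp.1.
exists p => n; rewrite (DP n).2; split=> //; apply: filterS (pD' n) => x; exact.
Qed.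

(** Invariance puts the translates of [q] by elements of [K] in the flow, and their limit along [p]
    stays there. *)
Lemma flow_mul (p q : set_system G) :
  UltraFilter p -> p K -> flow q -> flow (mulu p q).
Proof.
move=> pU pK [qU Fq]; split; first exact: mulu_ultra.
move=> X FX; apply: filterS pK => a Ka; apply: Fq.
by have := invf_translate F_inv (KV Ka) FX; rewrite /translate /= invgK.
Qed.

Lemma flow_translate (g : G) (p : set_system G) :
  K g -> flow p -> flow (mulu (principal_filter g) p).
Proof.
move=> Kg; apply: flow_mul; first exact: principal_filter_ultra.
exact/principal_filterP.
Qed.

Lemma translate_semiopen (g : G) :
  K g -> semiopen flow_basis flow_basis (mulu (principal_filter g)).
Proof.
move=> Kg _ [D pD ->]; exists [set p | flow p /\ p (translate g D)].
split; first exact/flow_basisP/positive_translate.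
move=> _ [D' pD' ->] D'D.
exists [set p | flow p /\ p (translate g^-1%g D')]; split.
- by apply: flow_basisP; apply: positive_translate => //; exact: KV.
- move=> p [fp pD'p]; split=> //.
  have [|_] := D'D (mulu (principal_filter g) p).
    by split; [exact: flow_translate|rewrite mulu_principal].
  by rewrite mulu_principal translateK.
- move=> _ [p [fp pD'p] <-]; split; first exact: flow_translate.
  by rewrite mulu_principal.
Qed.

(* Otherwise finitely many translates of [D], which cover an element of [F],
   would all have negligible trace on the preimage of a single positive set.
   That preimage would then be negligible, although finitely many of its
   translates cover [K]. *)
Lemma right_mul_positive (q : set_system G) (D : set G) :
  flow q -> positive D -> exists2 D1, positive D1 &
  forall D', positive D' -> D' `<=` D1 ->
    positive (D `&` [set a | q [set b | D' (a * b)%g]]).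
Proof.
move=> fq pD; have [qU Fq] := fq; apply: contrapT => noD1.
pose rho Y := [set a | q [set b | Y (a * b)%g]].
have rhoS Y Y' : Y `<=` Y' -> rho Y `<=` rho Y'.
  by move=> YY' a; apply: filterS => b; exact: YY'.
have rho_tr g Y : rho (translate g Y) = translate g (rho Y).
  by apply/funext => a; rewrite /rho /translate /=; congr q; apply/funext => b;
    rewrite /= mulgA.
have {}noD1 D1 : positive D1 -> exists D', [/\ positive D', D' `<=` D1 &
    F (~` (D `&` rho D'))].
  move=> pD1; apply: contrapT => noD'; apply: noD1; exists D1 => // D' pD' D'D1.
  by move=> FD; apply: noD'; exists D'.
have [gs Kgs Fgs] := syndetic pD.
(* [Y] is shrunk once for each [g] of the list: [noD1] is applied to the translate of [Y] by the
   inverse of [g], and the result is translated back. *)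
have [Y pY nY] : exists2 Y, positive Y &
    forall g, g \in gs -> F (~` (translate g D `&` rho Y)).
  elim: gs Kgs {Fgs} => [|g gs IH] Kgs.
    exists setT => //; rewrite /positive setCT; exact: filter_not_empty.
  have [|Y pY nY] := IH; first by move=> h hgs; apply: Kgs; rewrite inE hgs orbT.
  have Kg : K g by apply: Kgs; rewrite mem_head.
  have [D' [pD' D'Y nD']] := noD1 _ (positive_translate (KV Kg) pY).
  have gD'Y : translate g D' `<=` Y.
    by move=> x /D'Y; rewrite /translate /= invgK mulVKg.
  exists (translate g D'); first exact: positive_translate.
  move=> h; rewrite inE => /predU1P[->|hgs].
    by have := invf_translate F_inv Kg nD'; rewrite rho_tr.
  by apply: filterS (nY h hgs) => x nx [hx /(rhoS _ _ gD'Y) rx]; apply: nx.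
have {}nY : F (~` rho Y).
  have : F [set x | forall g, g \in gs -> ~ (translate g D x /\ rho Y x)].
    elim: gs nY {Kgs Fgs} => [|g gs IH] nY; first by apply: filterE => x.
    have nYg := nY g (mem_head _ _).
    have := IH (fun h hgs => nY h (mem_behead (s := g :: gs) hgs)).
    move=> /(filterI nYg); apply: filterS => x [nx nxs] h.
    by rewrite inE => /predU1P[->|/nxs].
  move=> /(filterI Fgs); apply: filterS => x [[g gsg gD] nx] rx.
  exact: (nx g gsg).
have [hs Khs Fhs] := syndetic pY.
have : F [set x | forall h, h \in hs -> ~ translate h (rho Y) x].
  elim: hs Khs {Fhs} => [|h hs IH] Khs; first by apply: filterE => x.
  have := IH (fun g ghs => Khs g (mem_behead (s := h :: hs) ghs)).
  have := invf_translate F_inv (Khs h (mem_head _ _)) nY.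
  move=> nx /(filterI nx); apply: filterS => x [nhx nxs] g.
  by rewrite inE => /predU1P[->|/nxs].
move=> /(filterI (invf_K F_inv))/filter_ex[a [Ka na]].
have : q [set b | exists2 h, h \in hs & translate h Y (a * b)%g].
  apply: Fq; have := invf_translate F_inv (KV Ka) Fhs.
  by rewrite {1}/translate /= invgK.
move=> /ultra_bigcup_seq[h hhs qh].
by apply: (na h hhs); rewrite -rho_tr.
Qed.

Lemma right_mul_semiopen (q : set_system G) :
  flow q -> semiopen flow_basis flow_basis (fun p => mulu p q).
Proof.
move=> fq _ [D pD ->]; have [D1 pD1 D1P] := right_mul_positive fq pD.
exists [set p | flow p /\ p D1]; split; first exact: flow_basisP.
move=> _ [D2 pD2 ->] D21.
(* [D2] lies in [D1] only as seen by the flow, so it is cut down to a genuine subset. *)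
have pD' : positive (D2 `&` D1).
  have [p fp pD2p] := positive_chain (fun=> pD2) (fun _ _ _ => @subset_refl _ _).
  apply: (flow_positive fp); have [pU _] := fp.
  by have [_ pD1p] := D21 p (conj fp (pD2p 0)); exact: filterI (pD2p 0) pD1p.
have := D1P _ pD' (@subIsetr _ _ _); set D3 := (_ `&` _) => pD3.
exists [set p | flow p /\ p D3]; split; first exact: flow_basisP.
  by move=> p [fp pD3p]; have [pU _] := fp; split=> //; apply: filterS pD3p => x [].
move=> _ [p [fp pD3p] <-]; have [pU pK] := flow_K fp.
split; first exact: flow_mul.
have [qU _] := fq.
by apply: filterS pD3p => a [_]; apply: filterS => b [].
Qed.

End Flow.

(** * Subgroups of bounded index *)

Section Cosets.
Variables (G : groupType) (H : set G).
Hypothesis sH : subgroup H.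

Lemma subgroup1 : H 1%g.
Proof. by case: sH => /set_mem. Qed.

Lemma subgroupV (x : G) : H x -> H x^-1%g.
Proof. by move=> /mem_set Hx; apply/set_mem; exact: group_closedV sH _ Hx. Qed.

Lemma subgroupM (x y : G) : H x -> H y -> H (x * y)%g.
Proof.
by move=> /mem_set Hx /mem_set Hy; apply/set_mem; exact: group_closedM sH _ _ Hx Hy.
Qed.

Definition same_coset (x y : G) := H (x^-1 * y)%g.

Lemma same_coset_refl (x : G) : same_coset x x.
Proof. by rewrite /same_coset mulVg; exact: subgroup1. Qed.

Lemma same_coset_sym (x y : G) : same_coset x y -> same_coset y x.
Proof. by move=> /subgroupV; rewrite invgM invgK. Qed.

Lemma same_coset_trans (x y z : G) :
  same_coset x y -> same_coset y z -> same_coset x z.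
Proof.
by move=> xy yz; have := subgroupM xy yz; rewrite -mulgA mulVKg.
Qed.

Lemma same_cosetM (g x y : G) : same_coset (g * x)%g (g * y)%g <-> same_coset x y.
Proof. by rewrite /same_coset invgM -mulgA mulKg. Qed.

Lemma left_coset_eq (x y : G) :
  [set (x * h)%g | h in H] = [set (y * h)%g | h in H] -> same_coset x y.
Proof.
move=> /seteqP[_ /(_ y)[|h Hh <-]]; last by rewrite /same_coset mulKg.
by exists 1%g; [exact: subgroup1|rewrite mulg1].
Qed.

Lemma same_coset_eq (x y : G) : same_coset x y ->
  [set (x * h)%g | h in H] = [set (y * h)%g | h in H].
Proof.
have sub u v : same_coset u v ->
    [set (v * h)%g | h in H] `<=` [set (u * h)%g | h in H].
  move=> uv _ [h Hh <-]; exists (u^-1 * v * h)%g; first exact: subgroupM.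
  by rewrite -mulgA mulVKg.
by move=> xy; apply/seteqP; split; apply: sub => //; exact: same_coset_sym.
Qed.

End Cosets.

(* [D1] and [D2] stand for the traces on [G] and [G * G] of the sets definable
   over a small set of parameters. *)
Section BoundedIndex.
Variables (G : groupType) (K H : set G).
Variables (D1 : set (set G)) (D2 : set (set (G * G))) (P : seq nat -> set G).

(** Being an intersection of members of [D1]: type-definability over the parameter set, expressed
    without formulas. *)
Definition closed_for (Y : set G) :=
  forall x, (forall X, D1 X -> Y `<=` X -> X x) -> Y x.

(** [D2_compact] stands for saturation over the parameter set; [H_core] stands for the fact that
    automorphisms over it fix every coset of [H]. *)
Hypotheses (sK : subgroup K) (sH : subgroup H) (HK : H `<=` K)
  (D1T : D1 setT) (D1C : forall X, D1 X -> D1 (~` X))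
  (D1I : forall X Y, D1 X -> D1 Y -> D1 (X `&` Y))
  (D2_fst : forall X, D1 X -> D2 [set z | X z.1])
  (D2_snd : forall X, D1 X -> D2 [set z | X z.2])
  (D2_mul : forall X, D1 X -> D2 [set z | X (z.1 * z.2)%g])
  (D2_div : forall X, D1 X -> D2 [set z | X (z.1^-1 * z.2)%g])
  (D2_compact : forall Phi : set_system (G * G), ProperFilter Phi ->
    exists z, forall X, D2 X -> Phi X -> X z)
  (K_closed : closed_for K) (P_closed : forall s, closed_for (P s))
  (H_souslin : H = \bigcup_(eta in [set: nat -> nat]) \bigcap_k P (mkseq eta k))
  (H_core : forall a a', K a -> K a' -> (forall X, D1 X -> X a -> X a') ->
    forall b, K b -> same_coset H (a * b)%g (a' * b)%g).

Let K1 : K 1%g := subgroup1 sK.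
Let KM : forall x y, K x -> K y -> K (x * y)%g := subgroupM sK.
Let KV : forall x, K x -> K x^-1%g := subgroupV sK.
Local Notation cs := (same_coset H).
Let cs_refl := same_coset_refl sH.
Let cs_sym := same_coset_sym sH.
Let cs_trans := same_coset_trans sH.

(* Congruence modulo the normal core of [H] in [K]. *)
Let eqv (x y : G) := forall b, K b -> cs (x * b)%g (y * b)%g.

Let eqv_cs (x y : G) : eqv x y -> cs x y.
Proof. by move=> /(_ 1%g K1); rewrite !mulg1. Qed.

Let eqv_sym (x y : G) : eqv x y -> eqv y x.
Proof. by move=> xy b Kb; apply/cs_sym/xy. Qed.

Let eqv_trans (x y z : G) : eqv x y -> eqv y z -> eqv x z.
Proof. by move=> xy yz b Kb; apply: cs_trans (xy b Kb) (yz b Kb). Qed.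

Let eqv_mull (g x y : G) : eqv x y -> eqv (g * x)%g (g * y)%g.
Proof. by move=> xy b Kb; rewrite -!mulgA; apply/same_cosetM/xy. Qed.

Let eqv_mulr (x y c : G) : K c -> eqv x y -> eqv (x * c)%g (y * c)%g.
Proof. by move=> Kc xy b Kb; rewrite -!mulgA; apply/xy/KM. Qed.

Let realizes (p : set_system G) (a : G) := forall X, D1 X -> p X -> X a.

Let bK (p : set_system G) := UltraFilter p /\ p K.

Let realizes_K (p : set_system G) (a : G) : bK p -> realizes p a -> K a.
Proof.
by move=> [pU pK] pa; apply: K_closed => X DX KX; apply: pa => //; apply: filterS pK.
Qed.

Let bK_principal (g : G) : K g -> bK (principal_filter g).
Proof.
by move=> Kg; split; [exact: principal_filter_ultra|exact/principal_filterP].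
Qed.

Let bK_mul (p q : set_system G) : bK p -> bK q -> bK (mulu p q).
Proof.
move=> [pU pK] [qU qK]; split; first exact: mulu_ultra.
by apply: filterS pK => a Ka; apply: filterS qK => b Kb; exact: KM.
Qed.

(** A realization of the Fubini product on pairs serves both factors and the product at once; this
    makes [real] multiplicative. *)
Let realize_mul (p q : set_system G) : bK p -> bK q -> exists a b,
  [/\ realizes p a, realizes q b & realizes (mulu p q) (a * b)%g].
Proof.
move=> [pU pK] [qU qK].
have [[a b] abP] := D2_compact
  (lim2_proper (@ultra_proper _ p pU) (@ultra_proper _ q qU)).
exists a, b; split=> X DX pX.
- apply: (abP _ (D2_fst DX)); apply: filterS pX => x Xx; exact: filterE.
- by apply: (abP _ (D2_snd DX)); apply: (@filterE _ p).
- exact: (abP _ (D2_mul DX)).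
Qed.

Let exists_real (p : set_system G) : exists a, bK p -> realizes p a.
Proof.
have [bp|nbp] := pselect (bK p); last by exists 1%g.
by have [a [b [pa _ _]]] := realize_mul bp bp; exists a.
Qed.

Let real (p : set_system G) : G := projT1 (cid (exists_real p)).

Let realP (p : set_system G) : bK p -> realizes p (real p).
Proof. by rewrite /real; case: cid. Qed.

Let real_K (p : set_system G) : bK p -> K (real p).
Proof. by move=> bp; apply: (realizes_K bp); exact: realP. Qed.

(** [D1] is closed under complements, so all realizations of [p] lie in the same members of [D1] and
    [H_core] applies. Thus [real p] is well defined modulo the core. *)
Let real_eqv (p : set_system G) (a : G) : bK p -> realizes p a -> eqv a (real p).
Proof.
move=> bp pa; apply: H_core; [exact: realizes_K pa|exact: real_K|].
move=> X DX Xa; have [pU _] := bp.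
have [pX|pnX] := in_ultra_setVsetC X pU; first exact: realP bp _ DX pX.
by case: (pa _ (D1C DX) pnX).
Qed.

(** Replacing [a] by [real p] changes a left factor; this calls for congruence modulo the core
    instead of equality of left cosets. *)
Let real_mul (p q : set_system G) :
  bK p -> bK q -> eqv (real (mulu p q)) (real p * real q)%g.
Proof.
move=> bp bq; have [a [b [pa qb pqab]]] := realize_mul bp bq.
apply: eqv_trans (eqv_sym (real_eqv (bK_mul bp bq) pqab)) _.
apply: eqv_trans (eqv_mull a (real_eqv bq qb)) _.
by apply: eqv_mulr (real_eqv bp pa); exact: real_K.
Qed.

Let real_principal (g : G) : K g -> eqv (real (principal_filter g)) g.
Proof.
move=> Kg; apply/eqv_sym/real_eqv; first exact: bK_principal.
by move=> X _ /principal_filterP.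
Qed.

Let real_translate (g : G) (p : set_system G) :
  K g -> bK p -> eqv (real (mulu (principal_filter g) p)) (g * real p)%g.
Proof.
move=> Kg bp; apply: eqv_trans (real_mul (bK_principal Kg) bp) _.
by apply: eqv_mulr; [exact: real_K|exact: real_principal].
Qed.

(** Compactness: the members of [p] and [q] in [D1] and the conditions [R i] generate a proper
    filter on pairs, as finitely many of them are satisfied at once. *)
Let realize_div (p q : set_system G) (R : nat -> set G) :
  bK p -> bK q -> (forall i, closed_for (R i)) ->
  (forall n X Y, D1 X -> D1 Y -> p X -> q Y -> exists a b,
    [/\ X a, Y b & forall i, i <= n -> R i (a^-1 * b)%g]) ->
  exists a b, [/\ realizes p a, realizes q b & forall i, R i (a^-1 * b)%g].
Proof.
move=> [pU pK] [qU qK] clR fin.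
pose Phi : set_system (G * G) := [set Z | exists n X Y,
  [/\ D1 X, D1 Y, p X & q Y] /\
  forall a b, X a -> Y b -> (forall i, i <= n -> R i (a^-1 * b)%g) -> Z (a, b)].
have PhiP : ProperFilter Phi.
  split=> [[n [X [Y [[DX DY pX qY] XYZ]]]]|].
    have [a [b [Xa Yb Rab]]] := fin n X Y DX DY pX qY.
    exact: XYZ Xa Yb Rab.
  split=> [|Z Z' [n [X [Y [[DX DY pX qY] XYZ]]]]
      [n' [X' [Y' [[DX' DY' pX' qY'] XYZ']]]]|Z Z' ZZ' [n [X [Y [XY XYZ]]]]].
  - exists 0, setT, setT; split=> //; split=> //; exact: filterT.
  - exists (maxn n n'), (X `&` X'), (Y `&` Y'); split.
      by split; [exact: D1I|exact: D1I|exact: filterI|exact: filterI].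
    move=> a b [Xa X'a] [Yb Y'b] Rab; split.
      by apply: XYZ => // i ni; apply: Rab; rewrite leq_max ni.
    by apply: XYZ' => // i ni; apply: Rab; rewrite leq_max ni orbT.
  - by exists n, X, Y; split=> // a b Xa Yb Rab; apply/ZZ'/XYZ.
have [[a b] abP] := D2_compact PhiP.
exists a, b; split=> [X DX pX|Y DY qY|i].
- apply: (abP _ (D2_fst DX)); exists 0, X, setT; split=> //.
  by split=> //; exact: filterT.
- apply: (abP _ (D2_snd DY)); exists 0, setT, Y; split=> //.
  by split=> //; exact: filterT.
- apply: clR => W DW RW; apply: (abP _ (D2_div DW)).
  exists i, setT, setT; split; first by split=> //; exact: filterT.
  by move=> x y _ _ /(_ i (leqnn i)); exact: RW.
Qed.

(** A Souslin scheme for the relation [E] below: [scheme s] asks for a whole branch extending [s],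
    its closed approximation [hull s] only for what [s] prescribes. *)
Let scheme (s : seq nat) (p q : set_system G) := exists a b (eta : nat -> nat),
  [/\ realizes p a, realizes q b, mkseq eta (size s) = s &
    forall n, P (mkseq eta n) (a^-1 * b)%g].

(** All prefixes of [s] are imposed, as [P] is not assumed to decrease along branches. *)
Let hull (s : seq nat) (p q : set_system G) := exists a b,
  [/\ realizes p a, realizes q b & forall i, P (take i s) (a^-1 * b)%g].

Let scheme_hull (s : seq nat) (p q : set_system G) : scheme s p q -> hull s p q.
Proof.
move=> [a [b [eta [pa qb etas Pab]]]]; exists a, b; split=> // i.
rewrite -etas; have [si|/ltnW is_] := leqP (size s) i.
  by rewrite take_oversize ?size_mkseq.
have -> : take i (mkseq eta (size s)) = mkseq eta i; last exact: Pab.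
by rewrite /mkseq -map_take take_iota (minn_idPl is_).
Qed.

Let scheme_split (s : seq nat) (p q : set_system G) :
  scheme s p q -> exists n, scheme (rcons s n) p q.
Proof.
move=> [a [b [eta [pa qb etas Pab]]]].
by exists (eta (size s)), a, b, eta; split=> //; rewrite size_rcons mkseqS etas.
Qed.

(** The pairs witnessing the hulls vary with [n]; compactness replaces them by a single pair good
    for the whole branch. *)
Let hull_branch (eta : nat -> nat) (p q : set_system G) : bK p -> bK q ->
  (forall n, hull (mkseq eta n) p q) -> scheme [::] p q.
Proof.
move=> bp bq hpq.
have [n|n X Y DX DY pX qY|a [b [pa qb Rab]]] :=
  @realize_div p q (fun i => P (mkseq eta i)) bp bq.
- exact: P_closed.
- have [a [b [pa qb Pab]]] := hpq n; exists a, b; split=> [||i ni].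
  + exact: pa.
  + exact: qb.
  + have := Pab i; rewrite /mkseq -map_take take_iota (minn_idPl ni); exact.
- by exists a, b, eta.
Qed.

(** By compactness a failure of [hull s] already shows on one member of [p] and one of [q]. *)
Let hull_closed (s : seq nat) (p q : set_system G) : bK p -> bK q ->
  ~ hull s p q -> exists X Y, [/\ p X, q Y &
    forall p' q', p' X -> q' Y -> D1 X /\ D1 Y /\ ~ hull s p' q'].
Proof.
move=> bp bq nh; apply: contrapT => noXY; apply: nh.
apply: (realize_div bp bq (R := fun i => P (take i s))) => [i|n X Y DX DY pX qY].
  exact: P_closed.
apply: contrapT => noab; apply: noXY; exists X, Y; split=> // p' q' p'X q'Y.
split=> //; split=> // -[a [b [pa qb Pab]]]; apply: noab; exists a, b.
by split=> //; [exact: pa|exact: qb].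
Qed.

Let scheme0 (p q : set_system G) :
  bK p -> bK q -> scheme [::] p q <-> cs (real p) (real q).
Proof.
move=> bp bq; split=> [[a [b [eta [pa qb _ Pab]]]]|].
  apply: cs_trans (cs_sym (eqv_cs (real_eqv bp pa))) _.
  apply: cs_trans (eqv_cs (real_eqv bq qb)).
  by rewrite /same_coset H_souslin; exists eta.
rewrite {1}/same_coset H_souslin => -[eta _ Pab].
by exists (real p), (real q), eta; split=> //; [exact: realP|exact: realP|move=> n; exact: Pab].
Qed.

Variable F : set_system G.
Hypotheses (F_inv : invariant_filter K F)
  (F_max : forall F', invariant_filter K F' -> F `<=` F' -> F' `<=` F).

Let BF := flow_basis F.
Let BF_cat : category_basis BF := flow_category F_inv.
Let BF2_cat : category_basis (boxes BF BF) := boxes_basis BF_cat BF_cat.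

Let flow_bK (p : set_system G) : flow F p -> bK p := @flow_K _ _ _ F_inv p.

Let BF_setT : BF [set p | flow F p /\ p setT].
Proof.
apply: flow_basisP => FT; have FP := invf_proper F_inv.
by apply: (filter_not_empty F); rewrite -setCT.
Qed.

Let flow_nonempty : exists p, flow F p.
Proof. by have [p [fp _]] := basis_nonempty BF_cat BF_setT; exists p. Qed.

Let E : set (set_system G * set_system G) := [set x | cs (real x.1) (real x.2)].

Lemma continuum_many_cosets : meager (boxes BF BF) E ->
  [set: set nat] #<= left_cosets K H.
Proof.
move=> /(mycielski BF_cat BF_setT)[p pflow pE].
pose chi (Y : set nat) n := `[< Y n >].
pose f (Y : set nat) := [set (real (p (chi Y)) * h)%g | h in H].
have f_inj : {in [set: set nat] &, injective f}.
  move=> Y Y' _ _ /(left_coset_eq sH) fYY'; apply: contrapT => YY'.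
  apply: (pE (chi Y) (chi Y') _ fYY') => chiE; apply: YY'; apply/funext => n.
  rewrite -[Y n]asboolE -[Y' n]asboolE; congr is_true.
  exact: (congr1 (fun g => g n) chiE).
have /card_eqPle[_ le] := inj_card_eq f_inj.
apply: card_le_trans le _; apply: subset_card_le => _ [Y _ <-].
exists (real (p (chi Y))) => //; apply/real_K/flow_bK.
by have [] := pflow (chi Y).
Qed.

(** The ambient type consists of all set systems; off the flow, where no basic set reaches,
    membership is vacuous. *)
Let flow2_scheme (s : seq nat) : set (set_system G * set_system G) :=
  [set x | flow F x.1 -> flow F x.2 -> scheme s x.1 x.2].

Lemma comeager_box : ~ meager (boxes BF BF) E -> exists D D',
  [/\ positive F D, positive F D' & meager (boxes BF BF)
    (([set p | flow F p /\ p D] `*` [set p | flow F p /\ p D']) `\` E)].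
Proof.
move=> nmE.
pose C s : set (set_system G * set_system G) :=
  [set x | flow F x.1 -> flow F x.2 -> hull s x.1 x.2].
have [s [p q] /not_implyP[fp /not_implyP[fq nh]]|s [p q] + fp fq|s [p q] Spq
  |[p q] eta hpq fp fq|mS|_ [_ [_ [[D pD ->] [D' pD' ->] ->]]] mD] :=
  @nikodym _ _ BF2_cat flow2_scheme C.
- have [X [Y [pX qY XY]]] := hull_closed (flow_bK fp) (flow_bK fq) nh.
  exists ([set p | flow F p /\ p X] `*` [set p | flow F p /\ p Y]); split=> //.
    exists [set p | flow F p /\ p X], [set p | flow F p /\ p Y]; split=> //.
      by apply: flow_basisP; exact: flow_positive fp pX.
    by apply: flow_basisP; exact: flow_positive fq qY.
  rewrite -subset0 => -[p' q'] [[[/= fp' p'X] [fq' q'Y]] /(_ fp' fq')] /=.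
  by have [_ []] := XY p' q' p'X q'Y.
- by move=> /(_ fp fq); exact: scheme_hull.
- have [[fp fq]|nf] := pselect (flow F p /\ flow F q); last first.
    by exists 0 => // fp fq; case: nf.
  by have [n Sn] := scheme_split (Spq fp fq); exists n.
- by apply: (hull_branch (eta := eta)); [exact: flow_bK|exact: flow_bK|
    move=> n; exact: hpq].
- apply: nmE; apply: sub_meager mS => -[p q] Epq fp fq.
  by apply/scheme0; [exact: flow_bK|exact: flow_bK|].
- exists D, D'; split=> //; apply: sub_meager mD => -[p q] [[[fp pX] [fq qY]] nE].
  by split=> // /(_ fp fq)/scheme0 Epq; apply/nE/Epq; exact: flow_bK.
Qed.

Let nthK (gs : seq G) (i : nat) : (forall g, g \in gs -> K g) -> K (nth 1%g gs i).
Proof.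
move=> Kgs; have [igs|igs] := ltnP i (size gs); first exact/Kgs/mem_nth.
by rewrite nth_default.
Qed.

(* Finitely many translates of a box in which [E] is comeager cover the square
   of the flow. Right multiplying the first coordinate by [q n] with
   [real (q n)] congruent to [k n], a point generic for all [n] falls into the
   same translate for two distinct values of [n]. *)
Lemma few_cosets (k : nat -> G) : (forall n, K (k n)) ->
  ~ meager (boxes BF BF) E -> exists n m, n != m /\ cs (k n) (k m).
Proof.
move=> Kk /comeager_box[D [D' [pD pD' mD]]].
have [gs Kgs Fgs] := syndetic K1 KM F_inv F_max pD.
have [hs Khs Fhs] := syndetic K1 KM F_inv F_max pD'.
have [q0 fq0] := flow_nonempty; have bq0 := flow_bK fq0.
pose q n := mulu (principal_filter (k n * (real q0)^-1)%g) q0.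
have Kc n : K (k n * (real q0)^-1)%g by apply: KM => //; exact/KV/real_K.
have fq n : flow F (q n) by exact: (flow_translate KV F_inv (Kc n) fq0).
have realq n : eqv (real (q n)) (k n).
  apply: eqv_trans (real_translate (Kc n) bq0) _.
  by rewrite mulgVK => b Kb; exact: cs_refl.
(* The index [(n, i, j)] says which [q n] multiplies the first coordinate and which translates of
   [D] and [D'] are to be brought back to [D] and [D']. *)
pose phi (x : nat * nat * nat) (y : set_system G * set_system G) :=
  (mulu (principal_filter (nth 1 gs x.1.2)^-1) (mulu y.1 (q x.1.1)),
   mulu (principal_filter (nth 1 hs x.2)^-1) y.2)%g.
have mphi x : meager (boxes BF BF) (phi x @^-1`
    (([set p | flow F p /\ p D] `*` [set p | flow F p /\ p D']) `\` E)).
  suff ophi : semiopen (boxes BF BF) (boxes BF BF) (phi x).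
    exact: meager_preimage ophi mD.
  have Kg i : K (nth 1%g gs i)^-1%g by exact/KV/nthK.
  have Kh i : K (nth 1%g hs i)^-1%g by exact/KV/nthK.
  have o1 := semiopen_comp (right_mul_semiopen K1 KM KV F_inv F_max (fq x.1.1))
    (translate_semiopen KV F_inv (Kg x.1.2)).
  have o2 := translate_semiopen KV F_inv (Kh x.2).
  exact: (semiopen_prod BF_cat BF_cat o1 o2).
have BT : boxes BF BF ([set p | flow F p /\ p setT] `*` [set p | flow F p /\ p setT]).
  by exists [set p | flow F p /\ p setT], [set p | flow F p /\ p setT]; split.
have [[p p'] [[/= fp _] [/= fp' _]] nphi] :=
  baire BF2_cat BT (meager_bigcup_countable mphi).
have bp := flow_bK fp; have bp' := flow_bK fp'.
have [p'U Fp'] := fp'; have [h hhs p'h] := ultra_bigcup_seq p'U (Fp' _ Fhs).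
have /choice[i iP] : forall n, exists i, i < size gs /\
    mulu p (q n) (translate (nth 1%g gs i) D).
  move=> n; have [pqU Fpq] := flow_mul KV F_inv bp.1 bp.2 (fq n).
  have [g ggs pg] := ultra_bigcup_seq pqU (Fpq _ Fgs).
  by exists (index g gs); rewrite index_mem nth_index.
have [n [m [nm inm]]] : exists n m, n != m /\ i n = i m.
  apply: contrapT => noij.
  have i_inj : {in `I_(size gs).+1 &, injective i}.
    move=> n m _ _ inm; apply: contrapT => /eqP nm; apply: noij.
    by exists n, m.
  suff: (size gs).+1 <= size gs by rewrite ltnn.
  by apply: (pigeonhole i_inj) => _ [n _ <-]; have [] := iP n.
exists n, m; split=> //.
have Kg n' : K (nth 1%g gs (i n')) := nthK _ Kgs.
have Kh := Khs _ hhs.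
pose j := index h hs; have jE : nth 1%g hs j = h by exact: nth_index.
(* Genericity puts the image pair in [E], and its second coordinate does not depend on [n']. *)
have csn n' : cs ((nth 1 gs (i n'))^-1 * (real p * k n'))%g
    (real (mulu (principal_filter h^-1%g) p')).
  have : E (phi (n', i n', j) (p, p')).
    apply: contrapT => nE; apply: nphi; exists (n', i n', j) => //; split=> //.
    split; split.
    - apply: (flow_translate KV F_inv); first exact: (KV (Kg n')).
      exact: (flow_mul KV F_inv bp.1 bp.2 (fq n')).
    - by rewrite /phi /= mulu_principal invgK; have [] := iP n'.
    - apply: (flow_translate KV F_inv) => //; rewrite /= jE; exact: KV.
    - by rewrite /phi /= mulu_principal invgK jE.
  rewrite /E /phi /= jE; apply: cs_trans; apply/cs_sym/eqv_cs.
  have bpq := bK_mul bp (flow_bK (fq n')).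
  apply: eqv_trans (real_translate (KV (Kg n')) bpq) _; apply: eqv_mull.
  apply: eqv_trans (real_mul bp (flow_bK (fq n'))) _; apply: eqv_mull.
  exact: realq.
have := cs_trans (csn n) (cs_sym (csn m)).
by rewrite inm => /same_cosetM/same_cosetM.
Qed.

Lemma finite_cosets : ~ meager (boxes BF BF) E -> finite_set (left_cosets K H).
Proof.
move=> nmE; apply: contrapT => /infiniteP/pcard_leP/injfunPex[f fun_f inj_f].
have /choice[k kP] : forall n, exists k, K k /\ f n = [set (k * h)%g | h in H].
  by move=> n; have [k Kk <-] := fun_f n I; exists k.
have [n [m [/eqP nm csnm]]] := few_cosets (fun n => (kP n).1) nmE.
apply: nm; apply: inj_f; rewrite ?inE // (kP n).2 (kP m).2.
exact: same_coset_eq.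
Qed.

(** * Relative definability when the index is finite *)

Section FiniteIndex.
Hypothesis fin : finite_set (left_cosets K H).

Let coset_reps : exists l : seq G, (forall r, r \in l -> K r) /\
  forall k, K k -> exists2 r, r \in l & cs r k.
Proof.
have [s sE] := (finite_seqP _).1 fin.
have /choice[f fP] : forall X : set G, exists r, left_cosets K H X ->
    K r /\ X = [set (r * h)%g | h in H].
  move=> X; have [[r Kr <-]|nX] := pselect (left_cosets K H X); last by exists 1%g.
  by exists r.
exists [seq f X | X <- s]; split=> [r /mapP[X Xs ->]|k Kk].
  by apply: (fP X _).1; rewrite sE.
pose X := [set (k * h)%g | h in H]; have LX : left_cosets K H X by exists k.
exists (f X); first by apply: map_f; move: LX; rewrite sE.
by apply: (left_coset_eq sH); rewrite -(fP X LX).2.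
Qed.

Let in_coset (k : G) : set (set_system G) := [set p | cs k (real p)].

Let meager_translate (g : G) (A A' : set (set_system G)) : K g ->
  (forall p, flow F p -> A p -> A' (mulu (principal_filter g) p)) ->
  meager BF A' -> meager BF A.
Proof.
move=> Kg AA' mA'.
apply: sub_meager (meagerU (meager_preimage (translate_semiopen KV F_inv Kg) mA')
  (nowhere_dense_meager (N := ~` flow F) _)).
  move=> p Ap; have [fp|nfp] := pselect (flow F p); last by right.
  by left; exact: AA'.
move=> _ [D pD ->]; exists [set p | flow F p /\ p D].
split=> //; first exact: flow_basisP.
by rewrite -subset0 => p [[fp _] /(_ fp)].
Qed.

(** Finitely many translates of [in_coset 1] cover the flow, so it is not meager. Fixing the
    principal ultrafilter at 1 as first coordinate of the scheme shows that it is Souslin, and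
    Nikodym's theorem applies. *)
Let comeager_coset : exists2 D, positive F D &
  meager BF ([set p | flow F p /\ p D] `\` in_coset 1%g).
Proof.
have nm1 : ~ meager BF (in_coset 1%g).
  move=> m1; have [l [Kl lP]] := coset_reps.
  have ml i : meager BF (in_coset (nth 1%g l i)).
    apply: (meager_translate (KV (nthK i Kl)) _ m1) => p fp csp.
    have := eqv_cs (eqv_sym (real_translate (KV (nthK i Kl)) (flow_bK fp))).
    apply: cs_trans; have := (same_cosetM H (nth 1 l i)^-1 _ _)%g.2 csp.
    by rewrite mulVg.
  have [p [fp _] nl] := baire BF_cat BF_setT (meager_bigcup_countable ml).
  have [r rl csr] := lP _ (real_K (flow_bK fp)).
  by apply: nl; exists (index r l) => //; rewrite /in_coset /= nth_index.
have b1 := bK_principal K1.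
pose A s : set (set_system G) := [set p | flow F p -> scheme s (principal_filter 1%g) p].
pose C s : set (set_system G) := [set p | flow F p -> hull s (principal_filter 1%g) p].
have [s p /not_implyP[fp nh]|s p + fp|s p Sp|p eta hp fp|mS|_ [D pD ->] mD] :=
  @nikodym _ _ BF_cat A C.
- have [X [Y [pX qY XY]]] := hull_closed b1 (flow_bK fp) nh.
  exists [set p | flow F p /\ p Y]; split=> //.
    by apply: flow_basisP; exact: flow_positive fp qY.
  rewrite -subset0 => p' [[fp' p'Y] /(_ fp')].
  by have [_ []] := XY _ p' pX p'Y.
- by move=> /(_ fp); exact: scheme_hull.
- have [fp|nf] := pselect (flow F p); last by exists 0 => // /nf.
  by have [n Sn] := scheme_split (Sp fp); exists n.
- by apply: (hull_branch (eta := eta)) => //; [exact: flow_bK|move=> n; exact: hp].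
- apply: nm1; apply: sub_meager mS => p csp fp.
  apply/(scheme0 b1 (flow_bK fp)); apply: cs_trans csp.
  exact: (eqv_cs (real_principal K1)).
- exists D => //; apply: sub_meager mD => p [[fp pX] nE]; split=> // /(_ fp).
  move=> /(scheme0 b1 (flow_bK fp)) cs1; apply: nE; apply: cs_trans cs1.
  exact: (eqv_cs (eqv_sym (real_principal K1))).
Qed.

(* The cosets of [H] are read off continuously from a point [p] of the flow by
   looking for the translates of [D] that belong to [p]; generically the result
   is the coset of [real p]. *)
Let limit_coset (D : set G) (p : set_system G) (k : G) :=
  exists g, [/\ K g, p (translate g D) & cs g k].

Let comeager_translate (D : set G) (g : G) : K g ->
  meager BF ([set p | flow F p /\ p D] `\` in_coset 1%g) ->
  meager BF ([set p | flow F p /\ p (translate g D)] `\` in_coset g).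
Proof.
move=> Kg; apply: (meager_translate (KV Kg)) => p fp [[_ pgD] ncs]; split.
  split; first exact: (flow_translate KV F_inv (KV Kg) fp).
  by rewrite mulu_principal invgK.
move=> cs1; apply: ncs; apply/(same_cosetM _ g^-1%g); rewrite mulVg.
exact: cs_trans cs1 (eqv_cs (real_translate (KV Kg) (flow_bK fp))).
Qed.

(** The two translates meet in a positive set, and a generic [q] containing it has [real q] in both
    cosets. *)
Let translate_coset (D : set G) (p : set_system G) (g g' : G) :
  meager BF ([set p | flow F p /\ p D] `\` in_coset 1%g) -> flow F p ->
  K g -> K g' -> p (translate g D) -> p (translate g' D) -> cs g g'.
Proof.
move=> mD fp Kg Kg' pg pg'; have [pU _] := fp.
have BU : BF [set q | flow F q /\ q (translate g D `&` translate g' D)].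
  by apply: flow_basisP; apply: flow_positive fp _; exact: filterI.
have [q [fq qgg'] nq] :=
  baire BF_cat BU (meagerU (comeager_translate Kg mD) (comeager_translate Kg' mD)).
have [qU _] := fq.
apply: (@cs_trans _ (real q)); last apply: cs_sym; apply: contrapT => ncs; apply: nq.
  by left; split=> //; split=> //; apply: filterS qgg' => x [].
by right; split=> //; split=> //; apply: filterS qgg' => x [].
Qed.

(** For almost all [a] along [x], [q] contains the translate of [D] by [a^-1 * k0]; by
    [translate_coset] this element is in the coset of [c]. *)
Let limit_coset_mul (D : set G) (x q : set_system G) (c k : G) :
  meager BF ([set p | flow F p /\ p D] `\` in_coset 1%g) -> bK x -> flow F q ->
  limit_coset D q c -> limit_coset D (mulu x q) k -> x [set a | cs (a * c)%g k].
Proof.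
move=> mD [xU xK] fq [c0 [Kc0 qc0 csc0]] [k0 [Kk0 xqk0 csk0]].
apply: filterS (filterI xK xqk0) => a [Ka qa].
have qa' : q (translate (a^-1 * k0)%g D).
  have [qU _] := fq; apply: filterS qa => b.
  by rewrite /translate /= invgM invgK mulgA.
have := translate_coset mD fq Kc0 (KM (KV Ka) Kk0) qc0 qa'.
move=> /(same_cosetM H a _ _).2; rewrite mulVKg => ck.
apply: cs_trans (cs_trans ck csk0); apply/same_cosetM; exact: cs_sym.
Qed.

(** The action of [real x] on cosets of [H] is the limit along [x] of the actions of the elements of
    [K]. *)
Let limits (x : set_system G) :=
  forall c, K c -> x [set a | cs (a * c)%g (real x * c)%g].

(** For generic [p] the products of [p] with finitely many [q r], one per coset, avoid [Z], so their
    limit cosets are correct; [limit_coset_mul] turns this into a limit along [p]. *)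
Let limits_comeager : exists2 W, meager BF W &
  forall p, flow F p -> ~ W p -> limits p.
Proof.
have [D pD mD] := comeager_coset; have [l [Kl lP]] := coset_reps.
have [gs Kgs Fgs] := syndetic K1 KM F_inv F_max pD.
pose Z := \bigcup_i ([set p | flow F p /\ p (translate (nth 1%g gs i) D)] `\`
  in_coset (nth 1%g gs i)).
have mZ : meager BF Z.
  by apply: meager_bigcup => i; apply: comeager_translate => //; exact: nthK.
have goodP p : flow F p -> ~ Z p -> limit_coset D p (real p).
  move=> fp nZ; have [pU Fp] := fp.
  have [g ggs pg] := ultra_bigcup_seq pU (Fp _ Fgs).
  exists g; split=> //; first exact: Kgs.
  apply: contrapT => ncs; apply: nZ; exists (index g gs) => //.
  by rewrite /in_coset /= nth_index.
have [q0 [fq0 _] nZq0] := baire BF_cat BF_setT mZ.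
have bq0 := flow_bK fq0.
(* Translating the good point [q0] by [c r] makes both its value and its limit coset that of [r]. *)
pose c r := (r * (real q0)^-1)%g.
have Kc r : K r -> K (c r) by move=> Kr; apply: KM => //; exact/KV/real_K.
pose q r := mulu (principal_filter (c r)) q0.
have fq r : K r -> flow F (q r).
  by move=> /Kc Kcr; exact: (flow_translate KV F_inv Kcr fq0).
have qr r : K r -> limit_coset D (q r) r.
  move=> Kr; have [g [Kg qg csg]] := goodP q0 fq0 nZq0.
  exists (c r * g)%g; split; first by apply: KM => //; exact: Kc.
    by rewrite /q mulu_principal translateM translateK.
  by rewrite -[X in cs _ X](mulgVK (real q0)); apply/same_cosetM.
pose W := \bigcup_i [set p | Z (mulu p (q (nth 1%g l i)))].
exists W.
  apply: meager_bigcup => i.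
  have o := right_mul_semiopen K1 KM KV F_inv F_max (fq _ (nthK i Kl)).
  exact: (meager_preimage o mZ).
move=> p fp nW e Ke; have bp := flow_bK fp; have [r rl csr] := lP _ Ke.
have Kr := Kl _ rl; have bqr := flow_bK (fq _ Kr).
have [||g [Kg pg csg]] := goodP (mulu p (q r)).
- by have [pU pK] := bp; exact: (flow_mul KV F_inv pU pK (fq _ Kr)).
- by move=> Zp; apply: nW; exists (index r l) => //=; rewrite nth_index.
have pr : p [set a | cs (a * r)%g (real (mulu p (q r)))].
  by apply: limit_coset_mul mD bp (fq _ Kr) (qr _ Kr) _; exists g.
have [pU _] := bp; apply: filterS pr => a /= csa.
apply: (@cs_trans _ (a * r)%g); first by apply/same_cosetM; exact: cs_sym.
apply: cs_trans csa _.
apply: cs_trans (eqv_cs (real_mul bp bqr)) _; apply/same_cosetM.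
apply: cs_trans csr; apply: cs_trans (eqv_cs (real_translate (Kc _ Kr) bq0)) _.
by rewrite mulgVK; exact: cs_refl.
Qed.

(** Take [p] with [p] and [mulu p q] both generic. Along [q] the coset of [b * c] is constantly that
    of some [d]; comparing the two limits and cancelling [real p] identifies it. *)
Let limits_flow (q : set_system G) : flow F q -> limits q.
Proof.
move=> fq c Kc; have bq := flow_bK fq; have [qU qK] := bq.
have [l [Kl lP]] := coset_reps; have [W mW WP] := limits_comeager.
have o := right_mul_semiopen K1 KM KV F_inv F_max fq.
have [p [fp _] /not_orP[nWp nWpq]] :=
  baire BF_cat BF_setT (meagerU mW (meager_preimage o mW)).
have bp := flow_bK fp; have [pU pK] := bp.
have fpq := flow_mul KV F_inv pU pK fq.
have [d dl qd] : exists2 d, d \in l & q [set b | cs d (b * c)%g].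
  by apply: ultra_bigcup_seq; apply: filterS qK => b Kb; apply/lP/KM.
have Kd := Kl _ dl.
have pqc : p [set a | q [set b | cs (a * b * c)%g (real (mulu p q) * c)%g]] :=
  WP _ fpq nWpq c Kc.
have [a [/= pqa pa]] := filter_ex (filterI pqc (WP _ fp nWp d Kd)).
have [b [/= qb1 qb2]] := filter_ex (filterI pqa qd).
have csd : cs d (real q * c)%g.
  apply/(same_cosetM _ (real p)).
  apply: cs_trans (cs_sym pa) _.
  apply: (@cs_trans _ (a * (b * c))%g); first exact/same_cosetM.
  by rewrite !mulgA; apply: cs_trans qb1 _; exact: real_mul.
by apply: filterS qd => b' csb'; apply: cs_trans (cs_sym csb') csd.
Qed.

(** The product of [x] with a point [q] of the flow is in the flow; testing it on [(real q)^-1 * c]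
    cancels [q]. *)
Let limits_bK (x : set_system G) : bK x -> limits x.
Proof.
move=> bx c Kc; have [q fq] := flow_nonempty; have bq := flow_bK fq.
have [xU xK] := bx; have fxq := flow_mul KV F_inv xU xK fq.
have Kc' : K ((real q)^-1 * c)%g by apply: KM => //; exact/KV/real_K.
have xqc : x [set a | q [set b | cs (a * b * ((real q)^-1 * c))%g
    (real (mulu x q) * ((real q)^-1 * c))%g]] := limits_flow fxq Kc'.
have := limits_flow fq Kc'; rewrite mulVKg => qc.
apply: filterS xqc => a /= qa.
have [qU _] := bq; have [b [/= qb1 qb2]] := filter_ex (filterI qc qa).
apply: (@cs_trans _ (a * (b * ((real q)^-1 * c)))%g).
  by apply/same_cosetM; exact: cs_sym.
rewrite !mulgA; rewrite !mulgA in qb2; apply: cs_trans qb2 _.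
have := real_mul bx bq Kc'; rewrite -[in X in cs _ X]mulgA mulVKg.
by rewrite mulgA.
Qed.

(** Hence an ultrafilter on [H] is not realized outside [H], nor one on the rest of [K] inside
    [H]. *)
Let limits_real (x : set_system G) (a : G) :
  bK x -> realizes x a -> x [set g | cs g a].
Proof.
move=> bx xa; have [xU _] := bx; have := limits_bK bx K1; apply: filterS => g /=.
by rewrite !mulg1 => csg; apply: cs_trans csg (eqv_cs (eqv_sym (real_eqv bx xa))).
Qed.

Let D1U (X Y : set G) : D1 X -> D1 Y -> D1 (X `|` Y).
Proof.
by move=> DX DY; rewrite -[_ `|` _]setCK setCU; apply/D1C/D1I; exact: D1C.
Qed.

Let H_cs (g a : G) : cs g a -> H g <-> H a.
Proof.
move=> csg; split=> Hx; first by rewrite -[a](mulVKg g); exact: subgroupM.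
rewrite -[g]invgK -[g^-1%g](mulgK a); apply: subgroupV => //.
by apply: subgroupM => //; exact: subgroupV.
Qed.

Let separated (X : set G) := D1 X /\ X `&` K `<=` H.

(** Otherwise [h] would realize an ultrafilter concentrated on [K] minus [H]. *)
Let separated_nbhd (h : G) : H h -> exists2 X, separated X & X h.
Proof.
move=> Hh; apply: contrapT => noX.
pose Phi : set_system G := [set Z | exists X,
  [/\ D1 X, X h & X `&` (K `\` H) `<=` Z]].
have PhiP : ProperFilter Phi.
  split=> [[X [DX Xh X0]]|].
    apply: noX; exists X => //; split=> // x [Xx Kx]; apply: contrapT => nHx.
    exact: (X0 x).
  split=> [|Z Z' [X [DX Xh XZ]] [X' [DX' Xh' XZ']]|Z Z' ZZ' [X [DX Xh XZ]]].
  - by exists setT.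
  - exists (X `&` X'); split; [exact: D1I|by []|].
    by move=> x [[Xx X'x] KHx]; split; [exact: XZ|exact: XZ'].
  - by exists X; split=> //; exact: subset_trans XZ ZZ'.
have [x [xU Phix]] := ultraFilterLemma PhiP.
have xKH : x (K `\` H) by apply: Phix; exists setT; split=> // z [].
have bx : bK x by split=> //; apply: filterS xKH => z [].
have xh : realizes x h.
  move=> X DX xX; apply: contrapT => nXh; apply: (filter_not_empty x).
  rewrite -(setICr X); apply: filterI => //; apply: Phix.
  by exists (~` X); split=> //; exact: D1C.
have [g [/= csg [_ nHg]]] := filter_ex (filterI (limits_real bx xh) xKH).
by apply: nHg; apply/(H_cs csg).
Qed.

(** Otherwise some ultrafilter on [H] avoids all separated sets, although its realization lies in
    [H] and so in one of them. *)
Lemma finite_index_definable : exists2 X, D1 X & H = K `&` X.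
Proof.
suff [X [DX XH] HX] : exists2 X, separated X & H `<=` X.
  exists X => //; apply/seteqP; split=> [h Hh|h [Kh Xh]]; last exact: XH.
  by split; [exact: HK|exact: HX].
apply: contrapT => noX.
pose Phi : set_system G := [set Z | exists2 X, separated X & H `\` X `<=` Z].
have PhiP : ProperFilter Phi.
  split=> [[X sX X0]|].
    by apply: noX; exists X => // h Hh; apply: contrapT => nXh; exact: (X0 h).
  split=> [|Z Z' [X [DX XH] XZ] [X' [DX' XH'] XZ']|Z Z' ZZ' [X sX XZ]].
  - exists set0 => //; split; last by move=> x [].
    by rewrite -setCT; exact: D1C.
  - exists (X `|` X').
      split; first exact: D1U.
      by move=> x [[Xx|X'x] Kx]; [exact: XH|exact: XH'].
    move=> x [Hx /not_orP[nX nX']].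
    by split; [exact: XZ|exact: XZ'].
  - by exists X => //; exact: subset_trans XZ ZZ'.
have [x [xU Phix]] := ultraFilterLemma PhiP.
have xH : x H.
  apply: Phix; exists set0; last by move=> z [].
  by split; [rewrite -setCT; exact: D1C|move=> z []].
have bx : bK x by split=> //; apply: filterS xH.
have [g [/= csg Hg]] := filter_ex (filterI (limits_real bx (realP bx)) xH).
have [X sX Xr] := separated_nbhd ((H_cs csg).1 Hg).
have xnX : x (~` X) by apply: Phix; exists X => // z [].
by have [DX _] := sX; exact: (realP bx (D1C DX) xnX).
Qed.

End FiniteIndex.

Lemma definable_or_continuum_many_cosets :
  (exists2 X, D1 X & H = K `&` X) /\ finite_set (left_cosets K H) \/
  [set: set nat] #<= left_cosets K H.
Proof.
have [mE|nmE] := pselect (meager (boxes BF BF) E).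
  by right; exact: continuum_many_cosets.
have fin := finite_cosets nmE.
by left; split=> //; exact: finite_index_definable.
Qed.

End BoundedIndex.

(** * Small sets *)

Section Small.
Variable kappa : Type.

Lemma small_le (T U : Type) (A : set T) (B : set U) :
  A #<= B -> small kappa B -> small kappa A.
Proof.
move=> AB [Bk nkB]; split; first exact: card_le_trans AB Bk.
by move=> kA; apply: nkB; exact: card_le_trans kA AB.
Qed.

Lemma card_le_inj (T U : Type) (A : set T) :
  inhabited U -> A #<= [set: U] -> exists f : T -> U, {in A &, injective f}.
Proof.
move=> iU; elim/Ppointed: U iU => [V [v]|V _ /pcard_injP//].
by have := no v.
Qed.

Hypotheses (kappa_limit : strong_limit kappa) (kappa_nat : small kappa [set: nat])
  (kappa_cof : forall F : nat -> set kappa, (forall k, small kappa (F k)) ->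
    small kappa (\bigcup_k F k)).

Let kappa_inh : inhabited kappa.
Proof.
apply: contrapT => nk; apply: kappa_nat.2.
suff -> : [set: kappa] = set0 by exact: card_ge0.
by rewrite -subset0 => x _; apply: nk.
Qed.

Lemma small_powerset (T : Type) (A : set T) :
  small kappa A -> small kappa [set B : set T | B `<=` A].
Proof.
move=> sA; have [f f_inj] := card_le_inj kappa_inh sA.1.
have sfA := small_le (card_image_le f A) sA.
apply: (small_le _ (kappa_limit sfA)).
have im_inj : {in [set B : set T | B `<=` A] &, injective (fun B => f @` B)}.
  have sub B B' : B `<=` A -> B' `<=` A -> f @` B `<=` f @` B' -> B `<=` B'.
    move=> BA B'A BB' x Bx; have [|y B'y /f_inj yx] := BB' (f x); first by exists x.
    by rewrite -yx ?inE //; [exact: B'A|exact: BA].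
  move=> B B'; rewrite !inE => BA B'A /seteqP[BB' B'B].
  by apply/seteqP; split; apply: sub.
have /card_eqPle[_ le] := inj_card_eq im_inj.
apply: card_le_trans le _; apply: subset_card_le => _ [B BA <-].
exact: image_subset.
Qed.

(* Each [x] in the union is coded by the Kuratowski pair of an index [k] with
   [F k x] and its image under an injection of [F k] into [kappa]. *)
Lemma small_bigcup (T : Type) (F : nat -> set T) :
  (forall k, small kappa (F k)) -> small kappa (\bigcup_k F k).
Proof.
move=> sF.
have [c c_inj] := card_le_inj kappa_inh kappa_nat.1.
have {}c_inj : injective c by move=> i j; apply: c_inj; rewrite inE.
have /choice[f f_inj] := fun k => card_le_inj kappa_inh (sF k).1.
(* Position 0 holds the codes of the indices, so [F j] moves to position [j.+1]. *)
pose S := \bigcup_k (if k is j.+1 then f j @` F j else range c).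
have sS : small kappa S.
  apply: kappa_cof => -[|j]; first exact: small_le (card_image_le _ _) kappa_nat.
  exact: small_le (card_image_le _ _) (sF j).
apply: (small_le _ (small_powerset (small_powerset sS))).
have /choice[i iP] : forall x, exists k, (\bigcup_k F k) x -> F k x.
  move=> x; have [[k _ Fk]|nF] := pselect ((\bigcup_k F k) x); first by exists k.
  by exists 0.
pose g x : set (set kappa) := [set [set c (i x)]; [set c (i x); f (i x) x]].
have g_inj : {in \bigcup_k F k &, injective g}.
  move=> x y; rewrite !inE => /iP Fx /iP Fy gxy.
  have cxy : c (i x) = c (i y).
    have : g y [set c (i x)] by rewrite -gxy; left.
    move=> [] eq; first by have : [set c (i x)] (c (i x)) by []; rewrite eq.
    by have : [set c (i x)] (c (i y)); [rewrite eq; left|].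
  have ixy := c_inj _ _ cxy.
  suff : f (i x) x = f (i x) y by apply: f_inj; rewrite ?inE // ixy.
  (* A Kuratowski pair may collapse: if the second coordinates differed, each would equal the common
     first one. *)
  have sub u v : i u = i v -> g u = g v -> f (i u) u <> f (i u) v ->
      f (i u) u = c (i u).
    move=> iuv guv neq; have : g v [set c (i u); f (i u) u] by rewrite -guv; right.
    move=> [] eq.
      by have : [set c (i u); f (i u) u] (f (i u) u); [right|rewrite eq iuv].
    have : [set c (i v); f (i v) v] (f (i u) u) by rewrite -eq; right.
    by rewrite -iuv => -[].
  have [//|neq] := pselect (f (i x) x = f (i x) y).
  rewrite (sub x y) // ixy (sub y x) // -ixy => eq; exact/neq/esym.
have /card_eqPle[_ le] := inj_card_eq g_inj.
apply: card_le_trans le _; apply: subset_card_le => _ [x Ux <-] Y.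
have cS : S (c (i x)) by exists 0 => //; exists (i x).
have fS : S (f (i x) x) by exists (i x).+1 => //; exists x => //; exact: iP.
by move=> [->|->] z => [->|[->|->]].
Qed.

Lemma small_bigcup_countable (T : Type) (I : countType) (F : I -> set T) :
  (forall i, small kappa (F i)) -> small kappa (\bigcup_i F i).
Proof.
move=> sF.
apply: (@small_le _ _ _ (\bigcup_k if unpickle k is Some i then F i else set0)).
  apply: subset_card_le => x [i _ Fx].
  by exists (pickle i) => //; rewrite pickleK.
apply: small_bigcup => k; case: unpickle => [i|]; first exact: sF.
exact: small_le (card_ge0 _ _) kappa_nat.
Qed.

Lemma smallU (T : Type) (A B : set T) :
  small kappa A -> small kappa B -> small kappa (A `|` B).
Proof.
move=> sA sB; have -> : A `|` B = \bigcup_(b in [set: bool]) (if b then A else B).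
  apply/seteqP; split=> x; last by move=> [[] _ Ax]; [left|right].
  by move=> [Ax|Bx]; [exists true|exists false].
by apply: small_bigcup_countable => -[].
Qed.

Lemma small1 (T : Type) (x : T) : small kappa [set x].
Proof. exact: small_le (finite_set_countable (finite_set1 x)) kappa_nat. Qed.

End Small.

(** * Definable sets and automorphisms *)

Section Renaming.
Variable L : language.

Fixpoint term_rename n m (r : 'I_n -> 'I_m) (t : term L n) : term L m :=
  match t with
  | Var i => Var L (r i)
  | App f ts => App (fun i => term_rename r (ts i))
  end.

Definition lift_renaming n m (r : 'I_n -> 'I_m) (i : 'I_n.+1) : 'I_m.+1 :=
  if unlift ord0 i is Some j then lift ord0 (r j) else ord0.

Fixpoint formula_rename n (phi : formula L n) :
    forall m, ('I_n -> 'I_m) -> formula L m :=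
  match phi in formula _ n return forall m, ('I_n -> 'I_m) -> formula L m with
  | Bot _ => fun m _ => Bot L m
  | Eq _ t u => fun m r => Eq (term_rename r t) (term_rename r u)
  | Rel _ R ts => fun m r => Rel (fun i => term_rename r (ts i))
  | Imp _ phi1 phi2 => fun m r => Imp (formula_rename phi1 r) (formula_rename phi2 r)
  | All _ phi1 => fun m r => All (formula_rename phi1 (lift_renaming r))
  end.

End Renaming.

Section TupleRename.
Variable T : Type.

(** Renaming variables along [r] pulls assignments back along [r], hence the reversed lengths. *)
Definition tuple_rename n m (r : 'I_n -> 'I_m) (v : m.-tuple T) :
  n.-tuple T := [tuple tnth v (r i) | i < n].

Lemma tnth_rename n m (r : 'I_n -> 'I_m) (v : m.-tuple T) i :
  tnth (tuple_rename r v) i = tnth v (r i).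
Proof. exact: tnth_mktuple. Qed.

Definition copair n l m (f : 'I_n -> 'I_m) (g : 'I_l -> 'I_m) (i : 'I_(n + l)) :=
  match fintype.split i with inl j => f j | inr j => g j end.

Lemma tuple_rename_copair n l m (f : 'I_n -> 'I_m) (g : 'I_l -> 'I_m)
    (v : m.-tuple T) :
  tuple_rename (copair f g) v = [tuple of tuple_rename f v ++ tuple_rename g v].
Proof.
apply: eq_from_tnth => i; rewrite tnth_rename /copair.
by case: split_ordP => j ->; rewrite ?tnth_lshift ?tnth_rshift tnth_rename.
Qed.

Lemma tuple_rename_comp n l m (f : 'I_n -> 'I_l) (g : 'I_l -> 'I_m)
    (v : m.-tuple T) :
  tuple_rename (fun i => g (f i)) v = tuple_rename f (tuple_rename g v).
Proof. by apply: eq_from_tnth => i; rewrite !tnth_rename. Qed.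

Lemma tuple_rename_lshift n l (v : n.-tuple T) (w : l.-tuple T) :
  tuple_rename (@lshift n l) [tuple of v ++ w] = v.
Proof. by apply: eq_from_tnth => i; rewrite tnth_rename tnth_lshift. Qed.

Lemma tuple_rename_rshift n l (v : n.-tuple T) (w : l.-tuple T) :
  tuple_rename (@rshift n l) [tuple of v ++ w] = w.
Proof. by apply: eq_from_tnth => i; rewrite tnth_rename tnth_rshift. Qed.

Lemma tuple_split n l (u : (n + l).-tuple T) :
  u = [tuple of tuple_rename (@lshift n l) u ++ tuple_rename (@rshift n l) u].
Proof.
apply: eq_from_tnth => i.
by case: (split_ordP i) => j ->; rewrite ?tnth_lshift ?tnth_rshift tnth_rename.
Qed.

End TupleRename.

Section SatRename.
Variables (L : language) (M : structure L).

Lemma term_eval_rename n m (r : 'I_n -> 'I_m) (v : m.-tuple M) (t : term L n) :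
  term_eval v (term_rename r t) = term_eval (tuple_rename r v) t.
Proof.
elim: t => [i|f ts IH] /=; first by rewrite tnth_rename.
by congr func_interp; apply: eq_mktuple.
Qed.

Lemma tuple_rename_lift n m (r : 'I_n -> 'I_m) (x : M) (v : m.-tuple M) :
  tuple_rename (lift_renaming r) [tuple of x :: v] =
  [tuple of x :: tuple_rename r v].
Proof.
apply: eq_from_tnth => i; rewrite tnth_rename /lift_renaming.
by case: unliftP => [j ->|->]; rewrite ?tnthS ?tnth_rename // !tnth0.
Qed.

Lemma sat_rename n (phi : formula L n) m (r : 'I_n -> 'I_m) (v : m.-tuple M) :
  sat (formula_rename phi r) v <-> sat phi (tuple_rename r v).
Proof.
elim: phi m r v => [k|k t u|k R ts|k p1 IH1 p2 IH2|k p IH] m r v //=.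
- by rewrite !term_eval_rename.
- suff -> : [tuple term_eval v (term_rename r (ts i)) | i < rel_arity R] =
    [tuple term_eval (tuple_rename r v) (ts i) | i < rel_arity R] by [].
  by apply: eq_mktuple => i; exact: term_eval_rename.
- by rewrite IH1 IH2.
- by split=> + x => /(_ x); rewrite IH tuple_rename_lift.
Qed.

Lemma sat_automorphism (s : M -> M) : automorphism s ->
  forall n (phi : formula L n) (v : n.-tuple M),
  sat phi (map_tuple s v) <-> sat phi v.
Proof.
move=> [[s' sK s'K] sf sr].
have s_inj := can_inj sK.
have teval n (t : term L n) (v : n.-tuple M) :
    term_eval (map_tuple s v) t = s (term_eval v t).
  elim: t => [i|f ts IH] /=; first by rewrite tnth_map.
  rewrite sf; congr func_interp; apply: eq_from_tnth => i.
  by rewrite tnth_mktuple tnth_map tnth_mktuple IH.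
move=> n; elim=> [k|k t u|k R ts|k p1 IH1 p2 IH2|k p IH] v //=.
- by rewrite !teval; split=> [/s_inj|->].
- have -> : [tuple term_eval (map_tuple s v) (ts i) | i < rel_arity R] =
      map_tuple s [tuple term_eval v (ts i) | i < rel_arity R].
    by apply: eq_from_tnth => i; rewrite tnth_mktuple tnth_map tnth_mktuple teval.
  exact: iff_sym (sr R _).
- by rewrite IH1 IH2.
- have mapE x : map_tuple s [tuple of x :: v] = [tuple of s x :: map_tuple s v].
    exact: val_inj.
  split=> + x => [/(_ (s x))|/(_ (s' x))].
    by rewrite -mapE IH.
  by rewrite -IH mapE s'K.
Qed.

End SatRename.

Section DefinableSets.
Variables (L : language) (M : structure L) (A : set M).

Lemma definable_overP n (X : set (n.-tuple M)) : definable_over A X <->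
  exists l (w : l.-tuple M) (phi : formula L (n + l)), (forall i, A (tnth w i)) /\
    forall v, X v <-> sat phi [tuple of v ++ w].
Proof.
split=> [[[l phi w] [Aw ->]]|[l [w [phi [Aw Xphi]]]]]; first by exists l, w, phi.
exists (PFormula phi w); split=> //; apply/funext => v; exact/propext/Xphi.
Qed.

Lemma definable_setT n : definable_over A [set: n.-tuple M].
Proof.
apply/definable_overP; exists 0, [tuple], (Imp (Bot L _) (Bot L _)).
by split=> [[m]|v] //; split=> // _ [].
Qed.

Lemma definable_setC n (X : set (n.-tuple M)) :
  definable_over A X -> definable_over A (~` X).
Proof.
move=> /definable_overP[l [w [phi [Aw Xphi]]]]; apply/definable_overP.
exists l, w, (Imp phi (Bot L _)); split=> // v.
by split=> [nX /Xphi|nX /Xphi].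
Qed.

Lemma definable_setI n (X Y : set (n.-tuple M)) :
  definable_over A X -> definable_over A Y -> definable_over A (X `&` Y).
Proof.
move=> /definable_overP[l1 [w1 [phi1 [Aw1 X1]]]].
move=> /definable_overP[l2 [w2 [phi2 [Aw2 X2]]]]; apply/definable_overP.
(* The parameter tuples are concatenated; [r1] and [r2] point each formula to its own block. *)
pose r1 := copair (@lshift n (l1 + l2)) (fun i => rshift n (@lshift l1 l2 i)).
pose r2 := copair (@lshift n (l1 + l2)) (fun i => rshift n (@rshift l1 l2 i)).
pose w := [tuple of w1 ++ w2].
exists (l1 + l2), w, (Imp (Imp (formula_rename phi1 r1)
  (Imp (formula_rename phi2 r2) (Bot L _))) (Bot L _)); split=> [i|v].
  by case: (split_ordP i) => j ->; rewrite ?tnth_lshift ?tnth_rshift.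
rewrite /= !sat_rename !tuple_rename_copair !tuple_rename_comp.
rewrite !tuple_rename_lshift !tuple_rename_rshift tuple_rename_lshift -X1 -X2.
by split=> [[Xv Yv]|nXY]; [exact|apply: contrapT => nX; apply: nXY => Xv Yv; apply: nX].
Qed.

Lemma definable_rename n m (r : 'I_n -> 'I_m) (X : set (n.-tuple M)) :
  definable_over A X -> definable_over A [set v | X (tuple_rename r v)].
Proof.
move=> /definable_overP[l [w [phi [Aw Xphi]]]]; apply/definable_overP.
exists l, w, (formula_rename phi (copair (fun i => lshift l (r i)) (@rshift m l))).
split=> // v; rewrite sat_rename tuple_rename_copair tuple_rename_comp.
by rewrite tuple_rename_lshift tuple_rename_rshift; exact: Xphi.
Qed.

Lemma definable_ex1 n (X : set (n.+1.-tuple M)) : definable_over A X ->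
  definable_over A [set v : n.-tuple M | exists x, X [tuple of x :: v]].
Proof.
move=> /definable_overP[l [w [phi [Aw Xphi]]]]; apply/definable_overP.
exists l, w, (Imp (@All L (n + l) (Imp phi (Bot L _))) (Bot L _)).
split=> // v; split=> [[x Xx] /= /(_ x)|nall].
  by apply; move/Xphi: Xx; congr sat; exact: val_inj.
apply: contrapT => noX; apply: nall => x /= phix; apply: noX; exists x.
by apply/Xphi; move: phix; congr sat; exact: val_inj.
Qed.

Lemma definable_ex m n (X : set ((m + n).-tuple M)) : definable_over A X ->
  definable_over A [set v : n.-tuple M | exists w : m.-tuple M, X [tuple of w ++ v]].
Proof.
elim: m X => [|m IH] X dX.
  suff -> : [set v : n.-tuple M | exists w : 0.-tuple M, X [tuple of w ++ v]] = X by [].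
  apply/seteqP; split=> v; last first.
    by move=> Xv; exists [tuple]; move: Xv; congr X; exact: val_inj.
  by move=> [w]; congr X; apply: val_inj => /=; rewrite (tuple0 w).
have := IH _ (definable_ex1 (n := m + n) dX); congr definable_over.
apply/seteqP; split=> v [w].
  by move=> [x Xx]; exists [tuple of x :: w]; move: Xx; congr X; exact: val_inj.
case/tupleP: w => x w Xx; exists w, x; move: Xx; congr X; exact: val_inj.
Qed.

End DefinableSets.

Lemma cat_tuple_inj (T : Type) n m (a a' : n.-tuple T) (b b' : m.-tuple T) :
  [tuple of a ++ b] = [tuple of a' ++ b'] -> a = a' /\ b = b'.
Proof.
move=> ab; have := congr1 (tuple_rename (@lshift n m)) ab.
have := congr1 (tuple_rename (@rshift n m)) ab.
by rewrite !tuple_rename_lshift !tuple_rename_rshift.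
Qed.

(** * Traces on the group of sets definable over a parameter set *)

Section Traces.
Variables (L : language) (C : structure L) (n : nat) (G : definable_group C n).
Variable A : set C.

Lemma definable_overS (A' : set C) m (X : set (m.-tuple C)) :
  A' `<=` A -> definable_over A' X -> definable_over A X.
Proof. by move=> A'A [phi [Aphi ->]]; exists phi; split=> // i; exact/A'A/Aphi. Qed.

Definition embed2 (z : G * G) : (n + n).-tuple C :=
  [tuple of embed z.1 ++ embed z.2].

Definition trace1 : set (set G) :=
  [set Z | exists2 X, definable_over A X & Z = [set g | X (embed g)]].

Definition trace2 : set (set (G * G)) :=
  [set Z | exists2 X, definable_over A X & Z = [set z | X (embed2 z)]].

Let graph : set ((n + (n + n)).-tuple C) := [set abc | exists g h : G,
  abc = [tuple of embed g ++ (embed h ++ embed (g * h)%g)]].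

Let graph_definable : definable_over A graph.
Proof. by apply: definable_overS (mul_definable G). Qed.

Let graphP (g h : G) (w : n.-tuple C) :
  graph [tuple of embed g ++ (embed h ++ w)] <-> w = embed (g * h)%g.
Proof.
split=> [[g' [h' /cat_tuple_inj[/embed_inj -> /cat_tuple_inj[/embed_inj -> ->]]]] //|->].
by exists g, h.
Qed.

Lemma trace1T : trace1 setT.
Proof. by exists setT => //; exact: definable_setT. Qed.

Lemma trace1C (X : set G) : trace1 X -> trace1 (~` X).
Proof. by move=> [Y dY ->]; exists (~` Y) => //; exact: definable_setC. Qed.

Lemma trace1I (X Y : set G) : trace1 X -> trace1 Y -> trace1 (X `&` Y).
Proof.
by move=> [X' dX ->] [Y' dY ->]; exists (X' `&` Y') => //; exact: definable_setI.
Qed.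

Lemma trace2_fst (X : set G) : trace1 X -> trace2 [set z | X z.1].
Proof.
move=> [Y dY ->]; exists [set v | Y (tuple_rename (@lshift n n) v)].
  exact: definable_rename.
by apply/funext => z; rewrite /= tuple_rename_lshift.
Qed.

Lemma trace2_snd (X : set G) : trace1 X -> trace2 [set z | X z.2].
Proof.
move=> [Y dY ->]; exists [set v | Y (tuple_rename (@rshift n n) v)].
  exact: definable_rename.
by apply/funext => z; rewrite /= tuple_rename_rshift.
Qed.

(** Preimages under a definable map are projections; [r] permutes the blocks of [w] and of the pair
    into the order of the graph. *)
Let graph_trace (r : 'I_(n + (n + n)) -> 'I_(n + (n + n))) (X : set (n.-tuple C)) :
  definable_over A X -> trace2 [set z : G * G | exists2 w : n.-tuple C,
    graph (tuple_rename r [tuple of w ++ embed2 z]) & X w].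
Proof.
move=> dX; exists [set v : (n + n).-tuple C | exists w : n.-tuple C,
    ([set u | graph (tuple_rename r u)] `&`
     [set u | X (tuple_rename (@lshift n (n + n)) u)]) [tuple of w ++ v]].
  by apply: definable_ex; apply: definable_setI; exact: definable_rename.
apply/seteqP; split=> z [w] /=.
  by move=> gw Xw; exists w; split=> //=; rewrite tuple_rename_lshift.
by rewrite tuple_rename_lshift => -[gw Xw]; exists w.
Qed.

Lemma trace2_mul (X : set G) : trace1 X -> trace2 [set z | X (z.1 * z.2)%g].
Proof.
move=> [Y dY ->].
pose r := copair (fun i => rshift n (@lshift n n i))
  (copair (fun i => rshift n (@rshift n n i)) (@lshift n (n + n))).
have := graph_trace r dY; congr trace2; apply/funext => -[g h] /=.
have rE (w : n.-tuple C) : tuple_rename r [tuple of w ++ embed2 (g, h)] =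
    [tuple of embed g ++ (embed h ++ w)].
  rewrite !tuple_rename_copair !tuple_rename_comp tuple_rename_lshift.
  by rewrite tuple_rename_rshift tuple_rename_lshift tuple_rename_rshift.
apply/propext; split=> [[w]|Yw]; first by rewrite rE => /graphP ->.
by exists (embed (g * h)%g) => //; rewrite rE; apply/graphP.
Qed.

Lemma trace2_div (X : set G) : trace1 X -> trace2 [set z | X (z.1^-1 * z.2)%g].
Proof.
move=> [Y dY ->].
(* The quotient [w] of [g] and [h] is described by [g * w = h], so the graph of multiplication
   suffices. *)
pose r := copair (fun i => rshift n (@lshift n n i))
  (copair (@lshift n (n + n)) (fun i => rshift n (@rshift n n i))).
have := graph_trace r dY; congr trace2; apply/funext => -[g h] /=.
have rE (w : n.-tuple C) : tuple_rename r [tuple of w ++ embed2 (g, h)] =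
    [tuple of embed g ++ (w ++ embed h)].
  rewrite !tuple_rename_copair !tuple_rename_comp tuple_rename_lshift.
  by rewrite tuple_rename_rshift tuple_rename_lshift tuple_rename_rshift.
apply/propext; split=> [[w]|Yw].
  rewrite rE => -[g' [h' /cat_tuple_inj[/embed_inj -> /cat_tuple_inj[->]]]].
  by move=> /embed_inj ->; rewrite mulKg.
by exists (embed (g^-1 * h)%g) => //; rewrite rE; apply/graphP; rewrite mulVKg.
Qed.

(** Formulas over [A] whose trace is in [Phi] are finitely satisfiable, as [Phi] is proper;
    saturation realizes them all. *)
Lemma trace_compact (kappa : Type) : saturated kappa C -> small kappa A ->
  forall Phi : set_system (G * G), ProperFilter Phi ->
  exists z, forall X, trace2 X -> Phi X -> X z.
Proof.
move=> sat_C sA Phi PhiP.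
pose p : set (pformula C (n + n)) :=
  [set phi | params_in A phi /\ Phi [set z | psat phi (embed2 z)]].
have [||v pv] := sat_C A _ p sA; first by move=> phi [].
  move=> q fq qp.
  have [s qs] := (finite_seqP (q : set {classic pformula C (n + n)})).1 fq.
  have : Phi [set z | forall phi : {classic pformula C (n + n)}, phi \in s ->
      psat phi (embed2 z)].
    have {qs} : forall phi : {classic pformula C (n + n)}, phi \in s -> p phi.
      by move=> phi phis; apply: qp; rewrite qs.
    elim: s => [|phi s IH] ps; first by apply: filterE => z.
    have [_ Phi1] := ps phi (mem_head _ _).
    have := IH (fun psi psis => ps psi (mem_behead (s := phi :: s) psis)).
    move=> /(filterI Phi1); apply: filterS => z [z1 z2] psi.
    by rewrite inE => /predU1P[->|/z2].
  move=> /filter_ex[z zs]; exists (embed2 z) => phi.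
  by rewrite qs; exact: zs.
have pX X : definable_over A X -> Phi [set z | X (embed2 z)] -> X v.
  by move=> [phi [Aphi ->]] Phi_phi; apply: pv.
(* The realization is so far only a tuple; definability of the image of [embed] makes it a pair of
   group elements. *)
have dG : definable_over A (range (@embed L C n G)).
  exact: definable_overS (embed_definable G).
have := pX _ (definable_setI (definable_rename (@lshift n n) dG)
  (definable_rename (@rshift n n) dG)).
case=> [|[g _ gv] [h _ hv]].
  apply: filterE => z; rewrite /embed2; split=> /=.
    by rewrite tuple_rename_lshift; exists z.1.
  by rewrite tuple_rename_rshift; exists z.2.
have vE : v = embed2 (g, h) by rewrite [LHS]tuple_split -gv -hv.
by exists (g, h) => _ [X dX ->] /(pX _ dX); rewrite vE.
Qed.

Lemma type_definable_closed (A' : set C) (X : set (n.-tuple C)) :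
  A' `<=` A -> type_definable_over A' X ->
  closed_for trace1 [set g : G | X (embed g)].
Proof.
move=> A'A [p [pA' ->]] g clg phi pphi.
apply: (clg [set g | psat phi (embed g)]); last by move=> h; exact.
exists (psat phi) => //; exists phi; split=> // i; exact/A'A/(pA' _ pphi).
Qed.

End Traces.

(** * Automorphisms over a parameter set *)

Section Automorphisms.
Variables (L : language) (C : structure L) (n : nat) (G : definable_group C n).

Lemma definable_automorphism (A : set C) (s : C -> C) m (X : set (m.-tuple C)) :
  automorphism s -> (forall x, A x -> s x = x) -> definable_over A X ->
  forall v, X v -> X (map_tuple s v).
Proof.
move=> aut_s sA /definable_overP[l [w [phi [Aw Xphi]]]] v /Xphi phiv; apply/Xphi.
have -> : [tuple of map_tuple s v ++ w] = map_tuple s [tuple of v ++ w].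
  apply: eq_from_tnth => i; case: (split_ordP i) => j ->.
    by rewrite tnth_lshift !tnth_map tnth_lshift.
  by rewrite tnth_rshift tnth_map tnth_rshift sA.
exact/sat_automorphism.
Qed.

Lemma automorphism_mul (s : C -> C) (g h g' h' : G) : automorphism s ->
  map_tuple s (embed g) = embed g' -> map_tuple s (embed h) = embed h' ->
  map_tuple s (embed (g * h)%g) = embed (g' * h')%g.
Proof.
move=> aut_s sg sh.
have s0 x : set0 x -> s x = x by [].
have [k [l]] := definable_automorphism aut_s s0 (mul_definable G)
  (ex_intro _ g (ex_intro _ h erefl)).
have -> : map_tuple s [tuple of embed g ++ (embed h ++ embed (g * h)%g)] =
    [tuple of map_tuple s (embed g) ++
      (map_tuple s (embed h) ++ map_tuple s (embed (g * h)%g))].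
  by apply: val_inj; rewrite /= !map_cat.
rewrite sg sh => /cat_tuple_inj[/embed_inj -> /cat_tuple_inj[/embed_inj -> ->]].
by [].
Qed.

Lemma same_type_automorphism (kappa : Type) (A : set C) (u u' : n.-tuple C) :
  strongly_homogeneous kappa C -> A !=set0 ->
  small kappa (A `|` range (tnth u)) ->
  (forall X, definable_over A X -> X u -> X u') ->
  exists s, [/\ automorphism s, forall x, A x -> s x = x & map_tuple s u = u'].
Proof.
move=> homC [x0 Ax0] sAu uu'.
(* [f] moves [u] to [u'] and fixes the rest; equality of types makes this consistent on repeated
   coordinates and on [A]. *)
pose f x := if pselect (exists i, x = tnth u i) is left e
  then tnth u' (projT1 (cid e)) else x.
have fA x : A x -> f x = x.
  move=> Ax; rewrite /f; case: pselect => // e; case: cid => i /= xi.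
  apply/esym; apply: (uu' [set v | x = tnth v i]) => //.
  apply/definable_overP; exists 1, [tuple x],
    (Eq (Var L (rshift n ord0)) (Var L (lshift 1 i))).
  split=> [j|v]; first by rewrite (ord1 j).
  by rewrite /= tnth_rshift tnth_lshift.
have fu i : f (tnth u i) = tnth u' i.
  rewrite /f; case: pselect => [e|[]]; last by exists i.
  case: cid => j /= ij; apply/esym.
  apply: (uu' [set v | tnth v i = tnth v j]) => //.
  apply/definable_overP; exists 0, [tuple],
    (Eq (Var L (lshift 0 i)) (Var L (lshift 0 j))).
  by split=> [[]|v] //=; rewrite !tnth_lshift.
have {}uu' X : definable_over A X -> X u <-> X u'.
  move=> dX; split; first exact: uu'.
  by move=> Xu'; apply: contrapT => /(uu' _ (definable_setC dX)).
have [|s [aut_s sf]] := homC _ f sAu.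
  move=> k phi v vA.
  (* Entries of [v] in [A] become parameters, the others are coordinates of [u]; [x0] is a
     placeholder for the latter. *)
  pose w := [tuple if pselect (A (tnth v j)) is left _ then tnth v j else x0 | j < k].
  have /choice[i iP] : forall j, exists i : 'I_(n + k),
      tnth [tuple of u ++ w] i = tnth v j /\ tnth [tuple of u' ++ w] i = f (tnth v j).
    move=> j; have [Av|nAv] := pselect (A (tnth v j)).
      exists (rshift n j); rewrite !tnth_rshift tnth_mktuple fA //.
      by case: pselect.
    have [//|[i _ <-]] := vA j.
    by exists (lshift k i); rewrite !tnth_lshift fu.
  have vE : v = tuple_rename i [tuple of u ++ w].
    by apply: eq_from_tnth => j; rewrite tnth_rename (iP j).1.
  have fvE : map_tuple f v = tuple_rename i [tuple of u' ++ w].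
    by apply: eq_from_tnth => j; rewrite tnth_map tnth_rename (iP j).2.
  have dphi : definable_over A
      [set z : n.-tuple C | sat phi (tuple_rename i [tuple of z ++ w])].
    apply/definable_overP; exists k, w, (formula_rename phi i); split=> [j|z].
      by rewrite tnth_mktuple; case: pselect.
    exact: iff_sym (sat_rename _ _ _).
  by have := uu' _ dphi; rewrite /= -vE -fvE.
exists s; split=> // [x Ax|]; first by rewrite sf ?fA //; left.
apply: eq_from_tnth => i; rewrite tnth_map sf ?fu //.
by right; exists i.
Qed.

(* An automorphism over [A] fixes the representatives of the cosets of [H],
   hence fixes each coset setwise. *)
Lemma same_type_cosets (kappa : Type) (A : set C) (H : set G) :
  strongly_homogeneous kappa C -> A !=set0 ->
  (forall a : G, small kappa (A `|` range (tnth (embed a)))) ->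
  subgroup H -> aut_invariant (points H) ->
  (forall g, exists2 c : G, same_coset H c g & forall i, A (tnth (embed c) i)) ->
  forall a a' : G, (forall X, trace1 (G := G) A X -> X a -> X a') ->
  forall b, same_coset H (a * b)%g (a' * b)%g.
Proof.
move=> homC A0 sA sH invH reps a a' aa' b.
have cs_trans := same_coset_trans sH; have cs_sym := same_coset_sym sH.
have [|s [aut_s sfix sa]] := same_type_automorphism homC A0 (sA a) (u' := embed a').
  by move=> X dX; apply: (aa' [set g | X (embed g)]); exists X.
have sfixt (c : G) : (forall i, A (tnth (embed c) i)) ->
    map_tuple s (embed c) = embed c.
  by move=> Ac; apply: eq_from_tnth => i; rewrite tnth_map sfix.
(* As [s] fixes [c] and [m], it carries [a * c = m * y] to [a' * c = m * y'], with [y'] in [H] by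
   invariance. *)
have [c cb /sfixt sc] := reps b; have [m mac /sfixt sm] := reps (a * c)%g.
pose y := (m^-1 * (a * c))%g.
have [y' Hy' sy] : points H (map_tuple s (embed y)).
  by rewrite -(invH s aut_s); exists (embed y) => //; exists y.
have acE : (m * y' = a' * c)%g.
  apply: (@embed_inj _ _ _ G); rewrite -(automorphism_mul aut_s sa sc).
  by rewrite -(automorphism_mul aut_s sm (esym sy)) /y mulVKg.
have step : same_coset H (a * c)%g (a' * c)%g.
  by apply: cs_trans (cs_sym _ _ mac) _; rewrite -acE /same_coset mulKg.
apply: (@cs_trans _ (a * c)%g); first by apply/same_cosetM; exact: cs_sym.
by apply: cs_trans step _; exact/same_cosetM.
Qed.

End Automorphisms.

Theorem corollary6p4 (kappa : Type) (L : language) (T : theory L)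
    (C : structure L) (n : nat) (G : definable_group C n) (H K : set G)
    (T_complete : complete_theory T)
    (C_models_T : models C T)
    (C_monster : monster kappa C)
    (H_subgroup : subgroup H)
    (H_bounded_index : small kappa (left_cosets [set: G] H))
    (H_invariant : aut_invariant (points H))
    (H_souslin : souslin (@type_definable kappa L C n) (points H))
    (K_subgroup : subgroup K)
    (K_type_definable : type_definable kappa (points K))
    (H_sub_K : H `<=` K) :
  (relatively_definable (points H) (points K) /\
   finite_set (left_cosets K H)) \/
  [set: set nat] #<= left_cosets K H.
Proof.
have [kappa_limit [kappa_nat _ _ kappa_cof] satC homC] := C_monster.
have [P [/choice[B PB] HP]] := H_souslin; have [AK [sAK KAK]] := K_type_definable.
have [x0] := carrier_inhabited C.
have /choice[rep repP] : forall X : set G, exists c,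
    left_cosets [set: G] H X -> X = [set (c * h)%g | h in H].
  move=> X; have [[c _ <-]|nX] := pselect (left_cosets [set: G] H X); last by exists 1%g.
  by exists c.
pose R (i : 'I_n) := [set tnth (embed (rep X)) i | X in left_cosets [set: G] H].
have smU := @smallU _ kappa_limit kappa_nat kappa_cof.
have sm_bigcup := small_bigcup_countable kappa_limit kappa_nat kappa_cof.
(* [A] collects the parameters of [K] and of the countably many [P s], and the coordinates of coset
   representatives, few by bounded index; [x0] makes it nonempty. *)
pose A := AK `|` [set x0] `|` \bigcup_s B s `|` \bigcup_i R i.
have sA : small kappa A.
  apply: (smU); last first.
    by apply: sm_bigcup => i; exact: small_le (card_image_le _ _) H_bounded_index.
  apply: (smU); last by apply: sm_bigcup => s; exact: (PB s).1.
  by apply: (smU) => //; exact: small1.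
have AKA : AK `<=` A by move=> x AKx; left; left; left.
have BA s : B s `<=` A by move=> x Bx; left; right; exists s.
have A0 : A !=set0 by exists x0; left; left; right.
have reps g : exists2 c : G, same_coset H c g & forall i, A (tnth (embed c) i).
  pose X := [set (g * h)%g | h in H].
  have LX : left_cosets [set: G] H X by exists g.
  exists (rep X) => [|i]; last by right; exists i => //; exists X.
  by apply: (left_coset_eq H_subgroup); rewrite -repP.
have sAa (a : G) : small kappa (A `|` range (tnth (embed a))).
  apply: (smU) => //.
  exact: small_le (finite_set_countable (finite_image _ finite_finset)) kappa_nat.
have core := same_type_cosets homC A0 sAa H_subgroup H_invariant reps.
have pointsE (Y : set G) : Y = [set g | points Y (embed g)].
  by apply/seteqP; split=> g; [exists g|move=> [h Yh /embed_inj <-]].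
have K_closed : closed_for (trace1 (G := G) A) K.
  by rewrite [K]pointsE; exact: type_definable_closed AKA KAK.
pose P' s := [set g : G | P s (embed g)].
have P_closed s : closed_for (trace1 (G := G) A) (P' s).
  exact: type_definable_closed (BA s) (PB s).2.
have HP' : H = \bigcup_(eta in [set: nat -> nat]) \bigcap_k P' (mkseq eta k).
  by rewrite [LHS]pointsE HP; apply/seteqP; split=> g [eta _ Pg]; exists eta.
have [F F_inv F_max] := maximal_invariant_filter (subgroup1 K_subgroup)
  (subgroupM K_subgroup) (subgroupV K_subgroup).
have [[[X [Y dY ->] HKX] fin]|] := @definable_or_continuum_many_cosets G K H (trace1 (G := G) A)
  (trace2 (G := G) A) P' K_subgroup H_subgroup H_sub_K (trace1T G A) (@trace1C _ _ _ G A)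
  (@trace1I _ _ _ G A) (@trace2_fst _ _ _ G A) (@trace2_snd _ _ _ G A)
  (@trace2_mul _ _ _ G A) (@trace2_div _ _ _ G A)
  (trace_compact satC sA) K_closed P_closed HP'
  (fun a a' _ _ aa' b _ => core a a' aa' b) F F_inv F_max; [left|by right].
split=> //; exists Y; split.
  by apply: definable_overS dY.
apply/seteqP; split=> [_ [h Hh <-]|_ [[g Kg <-] Yg]].
  by rewrite HKX in Hh; have [Kh Yh] := Hh; split=> //; exists h.
by exists g => //; rewrite HKX.
Qed.
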